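(* Let $G$ be an odd 2-dd all of whose alternating cycles have exactly 6 arcs, let $F$ be an open proper subgraph of $G$ with $n\geq 1$ exit vertices, and let $F'$ be an arbitrary open 2-digraph, all of whose alternating cycles have exactly 6 arcs, with the same number $n$ of exit vertices as $F$. Suppose $F'\sim F$, i.e. $R_F=xR_{F'}y$ for some $x,y\in S_n$. Then $F$ can be replaced by $F'$ in $G$ so that the resulting 2-dd $G'$ (all of whose alternating cycles have exactly 6 arcs) is H-equivalent to $G$.
   Context: **Permutations.** $S_n$ is the symmetric group on $\{1,\dots,n\}$, $A_n$ the set of even permutations, $\overline{A}_n=S_n-A_n$, and $C_n\subset S_n$ the set of permutations consisting of a single cycle of length $n$. A set $P\subseteq S_n$ is uniform if it is non-empty and either $P\subseteq A_n$ ($\pi(P)=0$) or $P\subseteq\overline{A}_n$ ($\pi(P)=1$); for an integer $n$, $\pi(n)\in\{0,1\}$ is its parity. For uniform $P$, $E_P=P^{-1}C_n=\{p^{-1}c: p\in P, c\in C_n\}$, and the residue is $R_P=\overline{A}_n-E_P$ if $\pi(P)=\pi(n)$, and $R_P=A_n-E_P$ otherwise. **Graphs.** A 2-digraph is a finite digraph in which each vertex has (in-degree, out-degree) equal to $(0,2)$ (an entry vertex), $(2,0)$ (an exit vertex) or $(2,2)$ (a saturated vertex). A 2-dd is a 2-digraph all of whose vertices are saturated. An alternating cycle (AC) is a sequence of $2r$ distinct arcs $(e_0,\dots,e_{2r-1})$ such that $e_i$ and $e_{i+1}$ (indices mod $2r$) have a common end-vertex if $i$ is even and a common start-vertex if $i$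 is odd; its forward arcs are the $e_i$ with $i$ even and its backward arcs those with $i$ odd. The arc set of a 2-digraph is uniquely partitioned into ACs. A subgraph of a 2-dd $G$ means the 2-digraph induced by a non-empty set $K$ of ACs of $G$ (all arcs of these ACs and their end-points); it is proper if $K$ is not the set of all ACs, and its complement is the subgraph $\overline{F}$ induced by the remaining ACs. The entry vertices of $F$ are exactly the exit vertices of $\overline{F}$, and vice versa. A factor of a 2-digraph is a spanning subgraph which, for every AC, contains either all its forward arcs and none of its backward arcs, or vice versa; it is a disjoint union of directed cycles and directed paths from entry to exit vertices. A factor is open if it contains no cycle; a 2-digraph is open if it has an open factor. The route of a factor is the bijection from entry vertices to exit vertices sending each entry vertex to the end of the path starting there; a route is open if it is the route of at least one open factor. Labelling entry and exit vertices by $1,\dots,n$ makes routes permutations in $S_n$; when all ACs have 6 arcs the set of open routes of an open 2-digraph is uniform, and $R_F$ denotes the residue of this set (a change of labelling replaces $R_F$ by $uR_Fv$ for some $u,v\in S_n$, so $\sim$ does not depend on the labellings). A 2-dd is odd if every factor has an odd number of cycles. It is Hamiltonian if it has a directed cycle through all vertices. Two 2-dds are H-equivalent if both are Hamiltonian or both are non-Hamiltonian. **Replacement.** Replacing $F$ by $F'$ in $G$ means forming a 2-dd from the disjoint union of $\overline{F}$ and $F'$ by identifying the exit vertices of $\overline{F}$ with the entry vertices of $F'$ via some bijection, and the exit vertices of $F'$ with the entry vertices of $\overline{F}$ via some bijection; the claim is that such bijections exist making the result H-equivalent to $G$. *)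

(* Defs.v *)
From HB Require Import structures.
From mathcomp Require Import all_boot all_fingroup all_solvable.
Set Implicit Arguments.
Unset Strict Implicit.
Unset Printing Implicit Defensive.

(* Parallel arcs and loops are allowed.  Digraphs all of whose alternating
   cycles have 6 arcs have no parallel arcs, since two parallel arcs form an
   alternating cycle with 2 arcs. *)
Record digraph := Digraph {
  verts : finType;
  arcs : finType;
  src : arcs -> verts;
  tgt : arcs -> verts
}.

Section TwoDigraphs.
Variable G : digraph.
Implicit Types (v : verts G) (S : {set arcs G}).

Definition indeg v := #|[set a : arcs G | tgt a == v]|.
Definition outdeg v := #|[set a : arcs G | src a == v]|.

Definition is_entry v := (indeg v == 0) && (outdeg v == 2).
Definition is_exit v := (indeg v == 2) && (outdeg v == 0).
Definition is_saturated v := (indeg v == 2) && (outdeg v == 2).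

Definition entries := [set v | is_entry v].
Definition exits := [set v | is_exit v].

Definition is_2digraph :=
  forall v, [|| is_entry v, is_exit v | is_saturated v].
Definition is_2dd := forall v, is_saturated v.

(* [ordS] is the successor modulo the length of the sequence. *)
Definition is_ac r (e : {ffun 'I_(r.*2) -> arcs G}) :=
  [&& 0 < r, injectiveb e
    & [forall i : 'I_(r.*2),
        if odd i then src (e i) == src (e (ordS i))
        else tgt (e i) == tgt (e (ordS i))]].

(* An alternating cycle is identified with its set of arcs.  The bounds on r
   here and in [is_factor], and on k in [dicycles], only serve to make the
   quantification finite: the arcs of [e] are distinct. *)
Definition ACs : {set {set arcs G}} :=
  [set A : {set arcs G} |
    [exists r : 'I_#|arcs G|.+1, exists e : {ffun 'I_(r.*2) -> arcs G},
      is_ac e && (A == [set e i | i : 'I_(r.*2)])]].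

Definition all_ac6 := forall A, A \in ACs -> #|A| = 6.

Definition is_factor S :=
  [forall r : 'I_#|arcs G|.+1, forall e : {ffun 'I_(r.*2) -> arcs G},
    is_ac e ==> [forall i : 'I_(r.*2), (e i \in S) == ~~ odd i]
                || [forall i : 'I_(r.*2), (e i \in S) == odd i]].

Definition is_dicycle k (e : {ffun 'I_k -> arcs G}) :=
  [&& 0 < k, injectiveb (fun i => src (e i))
    & [forall i : 'I_k, tgt (e i) == src (e (ordS i))]].

Definition dicycles : {set {set arcs G}} :=
  [set C : {set arcs G} |
    [exists k : 'I_#|arcs G|.+1, exists e : {ffun 'I_k -> arcs G},
      is_dicycle e && (C == [set e i | i : 'I_k])]].

Definition cycles_in S := [set C in dicycles | C \subset S].

Definition is_open_factor S := is_factor S && (cycles_in S == set0).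
Definition is_open := exists S, is_open_factor S.

Definition is_odd := forall S, is_factor S -> odd #|cycles_in S|.

Definition hamiltonian :=
  exists2 C, C \in dicycles & forall v, exists2 a, a \in C & src a = v.

Definition step S : rel (verts G) :=
  fun u v => [exists a in S, (src a == u) && (tgt a == v)].

Section Routes.
Variable n : nat.

Definition labelling (A : {set verts G}) (l : 'I_n -> verts G) :=
  injective l /\ [set l i | i : 'I_n] = A.

(* An exit vertex has no outgoing arc, so the exit vertex reachable in S from
   an entry vertex is the end of the path of S starting there. *)
Definition open_routes (li lo : 'I_n -> verts G) : {set 'S_n} :=
  [set p : 'S_n | [exists S : {set arcs G},
    is_open_factor S && [forall i : 'I_n, connect (step S) (li i) (lo (p i))]]].

End Routes.
End TwoDigraphs.

Definition H_equivalent (G G' : digraph) := hamiltonian G <-> hamiltonian G'.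

Section Residue.
Variable n : nat.
Implicit Types P : {set 'S_n}.

Definition full_cycles : {set 'S_n} := [set c : 'S_n | #|porbits c| == 1].

(* For uniform P this is true when P consists of odd permutations. *)
Definition parity P : bool := ~~ (P \subset ('Alt_('I_n))%g).

(* [full_cycles] is closed under conjugation, so this set does not depend on
   whether products of permutations are read from left to right (as here) or
   from right to left. *)
Definition ediff P : {set 'S_n} :=
  [set (p^-1 * c)%g | p in P, c in full_cycles].

(* Meaningful for uniform P only. *)
Definition residue P : {set 'S_n} :=
  (if parity P == odd n then ~: ('Alt_('I_n))%g else ('Alt_('I_n))%g) :\: ediff P.

End Residue.

(* Relabelling replaces a residue R by u R v, so the choice of the labellings
   is immaterial. *)
Definition sim n (F F' : digraph) :=
  exists li lo li' lo',
    [/\ @labelling F n (entries F) li, @labelling F n (exits F) lo,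
        @labelling F' n (entries F') li', @labelling F' n (exits F') lo'
      & exists x y : 'S_n,
          residue (open_routes li lo)
          = [set (x * r * y)%g | r in residue (open_routes li' lo')]].

Section Subgraph.
Variables (G : digraph) (K : {set {set arcs G}}).

Definition sub_vert (v : verts G) :=
  [exists a in cover K, (src a == v) || (tgt a == v)].

Lemma sub_src (a : {a : arcs G | a \in cover K}) : sub_vert (src (val a)).
Proof. by apply/existsP; exists (val a); rewrite (valP a) eqxx. Qed.

Lemma sub_tgt (a : {a : arcs G | a \in cover K}) : sub_vert (tgt (val a)).
Proof. by apply/existsP; exists (val a); rewrite (valP a) eqxx orbT. Qed.

Definition subgraph : digraph :=
  @Digraph {v : verts G | sub_vert v} {a : arcs G | a \in cover K}
    (fun a => exist _ (src (val a)) (sub_src a))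
    (fun a => exist _ (tgt (val a)) (sub_tgt a)).

End Subgraph.

Definition complement (G : digraph) (K : {set {set arcs G}}) : digraph :=
  subgraph (ACs G :\: K).

Definition dunion (H H' : digraph) : digraph :=
  @Digraph (verts H + verts H')%type (arcs H + arcs H')%type
    (fun a => match a with inl b => inl (src b) | inr b => inr (src b) end)
    (fun a => match a with inl b => inl (tgt b) | inr b => inr (tgt b) end).

Section Identify.
Variables (H : digraph) (e : rel (verts H)).

Definition sym_clos : rel (verts H) := fun x y => e x y || e y x.

Lemma sym_clos_connect : connect_sym sym_clos.
Proof. by apply: sym_connect_sym => x y; rewrite /sym_clos orbC. Qed.

(* The quotient of H by the equivalence relation on vertices generated by e;
   [root] selects a canonical representative of each class. *)
Definition identify : digraph :=
  @Digraph {x : verts H | roots sym_clos x} (arcs H)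
    (fun a => exist _ (root sym_clos (src a))
                (roots_root sym_clos_connect (src a)))
    (fun a => exist _ (root sym_clos (tgt a))
                (roots_root sym_clos_connect (tgt a))).

End Identify.

Section Replace.
Variables H H' : digraph.
Variable phi : {v : verts H | is_exit v} -> {v : verts H' | is_entry v}.
Variable psi : {v : verts H' | is_exit v} -> {v : verts H | is_entry v}.

Definition glue_rel : rel (verts (dunion H H')) := fun x y =>
  match x, y with
  | inl u, inr v => [exists w, (val w == u) && (val (phi w) == v)]
  | inr v, inl u => [exists w, (val w == v) && (val (psi w) == u)]
  | _, _ => false
  end.

Definition glue : digraph := identify glue_rel.

End Replace.

(* Main.v *)
(* An open factor of F with route p and one of its complement with route q form
   together a factor of G whose cycles correspond to those of the permutation
   p * q: following the factor, the first return to the entry vertices of F is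
   p * q.  Hence G is Hamiltonian iff some open route q of the complement lies in
   E_P, P being the set of open routes of F.  Since G is odd, all such q have the
   parity for which q is outside E_P iff q is in the residue R_P, so relabelling
   F' so as to carry R_F' to R_F leaves the condition unchanged. *)

Require Import Defs.
From HB Require Import structures.
From mathcomp Require Import all_boot all_fingroup all_solvable.
From mathcomp Require Import zify.
Set Implicit Arguments.
Unset Strict Implicit.
Unset Printing Implicit Defensive.

(** Factors are defined through cyclic sequences of arcs, which are awkward to restrict or to glue.
    As all nonzero degrees are 2, every arc shares its source with exactly one other arc, and its
    target likewise; the ACs are the connected components of this relation, and a factor is a set
    that separates every related pair. This local form passes through subgraphs and gluings, and so
    does the 6-arc condition, which becomes the size of a component. G and G' are then two instances
    of one notion of gluing, and a single criterion for Hamiltonicity serves both. A Hamiltonian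
    cycle induces open factors on the two parts because, with n at least 1, it meets an exit of
    each. The sign class of R_F is read off the oddness of G; that of R_F' is compared with it
    through an element of the residue. *)

(** * Alternating cycles as connected components *)

Section Mate.
Variables (T : finType) (V : eqType) (f : T -> V).
Hypothesis fibre2 : forall a, #|[set b | f b == f a]| = 2.

Lemma fibre2_uniq a b c : b != a -> c != a -> f b = f a -> f c = f a -> b = c.
Proof.
move=> neba neca fba fca; have /eqP/cards2P [x [y [_ eq_fib]]] := fibre2 a.
have in_fib d : f d = f a -> d \in [set x; y] by rewrite -eq_fib inE => ->.
have := in_fib b fba; have := in_fib c fca; have := in_fib a erefl.
move: neba neca; rewrite !inE => /eqP neba /eqP neca.
by case/orP=> /eqP ?; case/orP=> /eqP ?; case/orP=> /eqP ?; subst.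
Qed.

(** The other element of the fibre through [a]; with two-element fibres the default is never taken.
    For [f] the source and the target map, the two mates are the involutions that walk along an
    AC. *)
Definition mate a := odflt a [pick b | (b != a) && (f b == f a)].

Lemma mateP a : mate a != a /\ f (mate a) = f a.
Proof.
rewrite /mate; case: pickP => [b /andP[neba /eqP] // | none].
have /subset_leq_card : [set b | f b == f a] \subset [set a].
  apply/subsetP=> b; rewrite !inE => fba.
  by have := none b; rewrite fba andbT => /negbFE.
by rewrite fibre2 cards1.
Qed.

Lemma mate_uniq a b : b != a -> f b = f a -> b = mate a.
Proof. by move=> neba fba; have [nem fm] := mateP a; exact: (fibre2_uniq neba nem fba fm). Qed.

Lemma mateK : involutive mate.
Proof.
move=> a; have [ne fa] := mateP a; apply/esym/mate_uniq; last by rewrite fa.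
by rewrite eq_sym.
Qed.

End Mate.

(* The map t (s t)^k is a reflection of the dihedral group generated by s and t,
   hence conjugate to s or to t. *)
Lemma iter_neq_reflection (T : eqType) (s t : T -> T) :
    involutive s -> involutive t -> (forall a, s a != a) -> (forall a, t a != a) ->
  forall k a, t (iter k (s \o t) a) != a.
Proof.
move=> sK tK s_neq t_neq k; elim/ltn_ind: k => -[|[|k]] IH a //=.
  by rewrite -[X in _ != X]tK (inj_eq (inv_inj tK)).
have := IH k (leqW (leqnn _)) (s (t a)).
apply: contra_neq => eq_a; have := iterSr k (s \o t) a; rewrite /= => <-.
by apply: (inv_inj sK); rewrite sK; apply: (inv_inj tK); rewrite tK.
Qed.

Section AlternatingCycles.
Variable G : digraph.
Implicit Types (a b c : arcs G) (v : verts G) (S : {set arcs G}).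

(** Adjacency along an AC, so that the ACs become connected components ([ACsP]). *)
Definition twin : rel (arcs G) :=
  fun a b => (a != b) && ((src a == src b) || (tgt a == tgt b)).

Lemma twin_sym : symmetric twin.
Proof. by move=> a b; rewrite /twin eq_sym (eq_sym (src a)) (eq_sym (tgt a)). Qed.

Lemma connect_twin_sym : connect_sym twin.
Proof. exact/sym_connect_sym/twin_sym. Qed.

Section ACSequence.
Variables (r : nat) (e : {ffun 'I_r.*2 -> arcs G}).
Hypothesis ac_e : is_ac e.

Let e_inj : injective e.
Proof. by case/and3P: ac_e => _ /injectiveP. Qed.

Let e_next (i : 'I_r.*2) : if odd i then src (e i) = src (e (ordS i))
                        else tgt (e i) = tgt (e (ordS i)).
Proof. by case/and3P: ac_e => _ _ /forallP/(_ i); case: ifP => _ /eqP. Qed.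

Lemma odd_ordS (i : 'I_r.*2) : odd (ordS i) = ~~ odd i.
Proof. by rewrite /= odd_mod ?odd_double. Qed.

Lemma ac_twinS i : twin (e i) (e (ordS i)).
Proof.
apply/andP; split; last by move: (e_next i); case: ifP => _ ->; rewrite eqxx ?orbT.
by apply/eqP=> /e_inj/(congr1 (fun j : 'I__ => odd j)); rewrite odd_ordS; case: odd.
Qed.

Lemma ac_alternate S :
    (forall a b, twin a b -> (b \in S) = ~~ (a \in S)) ->
  (forall i, (e i \in S) = ~~ odd i) \/ (forall i, (e i \in S) = odd i).
Proof.
move=> sepS; case/and3P: (ac_e) => r_gt0 _ _.
have r2_gt0 : 0 < r.*2 by rewrite double_gt0.
pose i0 := Ordinal r2_gt0.
have eS i : (e i \in S) = (e i0 \in S) (+) odd i.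
  case: i => k; elim: k => [|k IH] lt_k.
    by rewrite addbF; congr (e _ \in S); apply/val_inj.
  pose i := Ordinal (ltnW lt_k).
  have -> : Ordinal lt_k = ordS i by apply/val_inj; rewrite /= modn_small.
  by rewrite (sepS _ _ (ac_twinS i)) IH odd_ordS addbN.
by case: (e i0 \in S) eS => eS; [left | right] => i; rewrite eS.
Qed.

Hypothesis G2 : is_2digraph G.

Lemma outfibre2 a : #|[set b | src b == src a]| = 2.
Proof.
have : outdeg (src a) != 0 by rewrite cards_eq0; apply/set0Pn; exists a; rewrite inE.
by case/or3P: (G2 (src a)) => /andP[_ /eqP] // ->.
Qed.

Lemma infibre2 a : #|[set b | tgt b == tgt a]| = 2.
Proof.
have : indeg (tgt a) != 0 by rewrite cards_eq0; apply/set0Pn; exists a; rewrite inE.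
by case/or3P: (G2 (tgt a)) => /andP[/eqP degE _]; rewrite -/(indeg _) degE.
Qed.

(** The two neighbours of [e i] in the sequence already share its source and its target
    respectively, and fibres of size two leave room for no other twin. *)
Lemma ac_twin i b : twin (e i) b -> exists2 j, b = e j & odd j = ~~ odd i.
Proof.
have [twS twP] := (ac_twinS i, ac_twinS (ord_pred i)); rewrite ord_predK in twP.
have odd_pred : odd (ord_pred i) = ~~ odd i.
  by rewrite -[in RHS](ord_predK i) odd_ordS negbK.
have := e_next (ord_pred i); have := e_next i; rewrite ord_predK odd_pred.
move: twS twP => /andP[neS _] /andP[neP _] eqS eqPr /andP[ne_b].
rewrite eq_sym in ne_b; rewrite eq_sym in neS.
case: (boolP (odd i)) eqS eqPr => odd_i eqS eqPr /orP[]/eqP eq_b.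
- exists (ordS i); last by rewrite odd_ordS odd_i.
  exact: (fibre2_uniq outfibre2 ne_b neS (esym eq_b) (esym eqS)).
- exists (ord_pred i); last by rewrite odd_pred odd_i.
  exact: (fibre2_uniq infibre2 ne_b neP (esym eq_b) eqPr).
- exists (ord_pred i); last by rewrite odd_pred odd_i.
  exact: (fibre2_uniq outfibre2 ne_b neP (esym eq_b) eqPr).
- exists (ordS i); last by rewrite odd_ordS odd_i.
  exact: (fibre2_uniq infibre2 ne_b neS (esym eq_b) (esym eqS)).
Qed.

Lemma ac_component i : [set e j | j : 'I_r.*2] = [set b | connect twin (e i) b].
Proof.
apply/setP=> b; rewrite inE; apply/imsetP/idP => [[j _ ->{b}] | /connectP[p]].
  have con0 k (lt_k : k < r.*2) (lt_0 : 0 < r.*2) :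
      connect twin (e (Ordinal lt_0)) (e (Ordinal lt_k)).
    elim: k lt_k => [|k IH] lt_k.
      by apply/eq_connect0; congr (e _); apply/val_inj.
    apply: connect_trans (IH (ltnW lt_k)) _; apply: connect1.
    have -> : Ordinal lt_k = ordS (Ordinal (ltnW lt_k)).
      by apply/val_inj; rewrite /= modn_small.
    exact: ac_twinS.
  case: i j => [i lt_i] [j lt_j]; have lt_0 := leq_ltn_trans (leq0n _) lt_i.
  by apply: (connect_trans _ (con0 j lt_j lt_0)); rewrite connect_twin_sym con0.
elim: p i => [|c p IH] i /=; first by move=> _ ->; exists i.
by case/andP=> /ac_twin [j -> _]; apply: IH.
Qed.

End ACSequence.

Hypothesis G2 : is_2digraph G.

(** Starting from [a], the target mate [t] and the source mate [s] are applied in turn until the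
    walk closes up. *)
Lemma ac_through a :
  exists r : 'I_#|arcs G|.+1, exists e : {ffun 'I_r.*2 -> arcs G},
    is_ac e /\ exists i, a = e i.
Proof.
pose s := mate (@src G); pose t := mate (@tgt G).
have sK : involutive s := mateK (outfibre2 G2).
have tK : involutive t := mateK (infibre2 G2).
have s_neq b : s b != b := (mateP (outfibre2 G2) b).1.
have t_neq b : t b != b := (mateP (infibre2 G2) b).1.
have src_s b : src (s b) = src b := (mateP (outfibre2 G2) b).2.
have tgt_t b : tgt (t b) = tgt b := (mateP (infibre2 G2) b).2.
(* Two steps of the walk make one application of [z], so half the length of the AC is the order of
   [a] under [z]. *)
pose z := s \o t; have z_inj : injective z by apply: inj_comp; apply: inv_inj.
have ltr : fingraph.order z a < #|arcs G|.+1 by rewrite ltnS max_card.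
have lt0 : 0 < fingraph.order z a by apply: fingraph.order_gt0.
pose f k := let b := iter k./2 z a in if odd k then t b else b.
pose e := [ffun i : 'I_(fingraph.order z a).*2 => f i].
have lt_half (i : 'I_(fingraph.order z a).*2) : i./2 < fingraph.order z a.
  by have := ltn_ord i; lia.
(* An arc at an odd position never equals one at an even position: otherwise a reflection would have
   a fixed point. *)
have reflect_neq i j : t (iter i z a) != iter j z a.
  have := iter_neq_reflection sK tK s_neq t_neq => rn.
  case: (leqP j i) => [/subnK <- | /ltnW /subnK <-]; first by rewrite iterD rn.
  by rewrite eq_sym iterD -(inj_eq (inv_inj tK)) tK rn.
exists (Ordinal ltr), e; split; last first.
  have lt00 : 0 < (fingraph.order z a).*2 by lia.
  by exists (Ordinal lt00); rewrite ffunE.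
apply/and3P; split=> //; last first.
  apply/forallP=> i; rewrite !ffunE.
  have -> : f (ordS i) = f i.+1.
    have [lt_i|] := ltnP i.+1 (fingraph.order z a).*2; first by rewrite /= modn_small.
    move=> ge_i; have eq_i : i.+1 = (fingraph.order z a).*2.
      by apply/eqP; rewrite eqn_leq ge_i ltn_ord.
    by rewrite /= eq_i modnn /f odd_double doubleK iter_order.
  rewrite /f /= uphalf_half; case: (odd i) => /=; rewrite ?add0n ?add1n /=.
    by rewrite src_s.
  by rewrite tgt_t.
apply/injectiveP=> i j; rewrite !ffunE /f /= => eq_f; apply/val_inj => /=.
suff [eq_odd eq_half] : odd i = odd j /\ i./2 = j./2.
  by rewrite -(odd_double_half i) eq_odd eq_half odd_double_half.
have iter_inj : iter i./2 z a = iter j./2 z a -> i./2 = j./2.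
  by move=> eq_it; rewrite -(findex_iter (lt_half i)) eq_it findex_iter.
move: eq_f; case: odd; case: odd.
- by move/(inv_inj tK)/iter_inj.
- by move/eqP; rewrite (negPf (reflect_neq _ _)).
- by move/esym/eqP; rewrite (negPf (reflect_neq _ _)).
- by move/iter_inj.
Qed.

Lemma ACsP (A : {set arcs G}) :
  reflect (exists a, A = [set b | connect twin a b]) (A \in ACs G).
Proof.
rewrite inE; apply: (iffP existsP) => [[r /existsP[e /andP[ac_e /eqP ->]]] | [a ->]].
  case/and3P: (ac_e) => r_gt0 _ _; have r2_gt0 : 0 < r.*2 by rewrite double_gt0.
  by exists (e (Ordinal r2_gt0)); apply: ac_component.
have [r [e [ac_e [i ->]]]] := ac_through a.
by exists r; apply/existsP; exists e; rewrite ac_e eq_sym (ac_component ac_e G2 i) eqxx.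
Qed.

(** Twins occupy positions of opposite parity in an AC, so choosing all forward or all backward arcs
    amounts to separating each pair of twins. The bound on [r] in [is_factor] loses nothing, as
    [ac_through] finds every arc in an AC within it. *)
Lemma factorP S :
  reflect (forall a b, twin a b -> (b \in S) = ~~ (a \in S)) (is_factor S).
Proof.
apply: (iffP idP) => [/forallP facS a b | sepS].
  have [r [e [ac_e [i ->]]]] := ac_through a.
  move=> /(ac_twin ac_e G2) [j -> odd_j].
  have /forallP/(_ e)/implyP/(_ ac_e) := facS r.
  by case/orP=> /forallP eS; rewrite (eqP (eS i)) (eqP (eS j)) odd_j.
apply/forallP=> r; apply/forallP=> e; apply/implyP=> ac_e.
by have [] := ac_alternate ac_e sepS => eS; apply/orP; [left | right];
  apply/forallP=> i; rewrite eS.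
Qed.

Lemma all_ac6P : all_ac6 G <-> forall a, #|[set b | connect twin a b]| = 6.
Proof.
split=> [ac6 a | conn6 A /ACsP[a ->]]; last exact: conn6.
by apply/ac6/ACsP; exists a.
Qed.

Lemma cover_closed (K : {set {set arcs G}}) a b :
  K \subset ACs G -> twin a b -> (a \in cover K) = (b \in cover K).
Proof.
move=> sKA; suff cl c d : twin c d -> c \in cover K -> d \in cover K.
  by move=> tw; apply/idP/idP; apply: cl; rewrite // twin_sym.
move=> tw /bigcupP[A KA cA]; apply/bigcupP; exists A => //.
have /ACsP[x eqA] := subsetP sKA A KA; move: cA; rewrite eqA !inE => /connect_trans; apply.
exact: connect1.
Qed.

(** Each arc lies in exactly one AC, namely its component. *)
Lemma cover_compl (K : {set {set arcs G}}) a :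
  K \subset ACs G -> (a \in cover (ACs G :\: K)) = (a \notin cover K).
Proof.
move=> sKA; pose A := [set b | connect twin a b].
have onlyA B : B \in ACs G -> a \in B -> B = A.
  case/ACsP=> x ->; rewrite inE => con; apply/setP=> y; rewrite !inE.
  exact: same_connect connect_twin_sym _ _ con y.
have aA : a \in A by rewrite inE.
have ACA : A \in ACs G by apply/ACsP; exists a.
have -> : (a \in cover K) = (A \in K).
  apply/bigcupP/idP => [[B KB aB] | KA]; last by exists A.
  by rewrite -(onlyA B) // (subsetP sKA).
apply/bigcupP/idP => [[B] | nKA]; last by exists A; rewrite // inE nKA.
by rewrite inE => /andP[nKB ACB] aB; rewrite -(onlyA B).
Qed.

End AlternatingCycles.

Arguments twin {G}.

(** * Factors and their cycles *)

Section Next.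
Variable G : digraph.
Implicit Types (a b c : arcs G) (x y v : verts G) (S C : {set arcs G}).

(* For a factor S, the exits are fixed points of [nxt S]. *)
Definition nxt S v := if [pick a in S | src a == v] is Some a then tgt a else v.

(** For a factor [S], the cycle through [x], provided that the walk from [x] meets no exit. *)
Definition orbit_arcs S x := [set a in S | fconnect (nxt S) x (src a)].

Hypothesis G2 : is_2digraph G.

Lemma not_exit_src a : ~~ is_exit (src a).
Proof.
apply/negP=> /andP[_]; rewrite /outdeg cards_eq0 => /eqP/setP/(_ a).
by rewrite !inE eqxx.
Qed.

Lemma not_entry_tgt a : ~~ is_entry (tgt a).
Proof.
apply/negP=> /andP[+ _]; rewrite /indeg cards_eq0 => /eqP/setP/(_ a).
by rewrite !inE eqxx.
Qed.

Lemma entry_not_exit v : is_entry v -> ~~ is_exit v.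
Proof. by case/andP=> /eqP d0 _; rewrite /is_exit d0. Qed.

Section Factor.
Variable S : {set arcs G}.
Hypothesis facS : is_factor S.

Lemma factor_src_inj : {in S &, injective (@src G)}.
Proof.
move=> a b aS bS eq_ab; apply/eqP; apply: contraLR bS => neab.
by have /(factorP G2)/(_ a b) -> := facS; rewrite ?aS // /twin neab eq_ab eqxx.
Qed.

Lemma factor_tgt_inj : {in S &, injective (@tgt G)}.
Proof.
move=> a b aS bS eq_ab; apply/eqP; apply: contraLR bS => neab.
by have /(factorP G2)/(_ a b) -> := facS; rewrite ?aS // /twin neab eq_ab eqxx orbT.
Qed.

Lemma nxt_src a : a \in S -> nxt S (src a) = tgt a.
Proof.
rewrite /nxt => aS; case: pickP => [b /andP[bS /eqP eq_ba] | /(_ a)].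
  by rewrite (factor_src_inj bS aS).
by rewrite aS eqxx.
Qed.

Lemma factor_out v : ~~ is_exit v -> exists2 a, a \in S & src a = v.
Proof.
move=> nexit; have /eqP/cards2P[a [b [neab eq_ab]]] : outdeg v = 2.
  by case/or3P: (G2 v) nexit => [/andP[_ /eqP] | -> | /andP[_ /eqP]].
have [src_a src_b] : src a = v /\ src b = v.
  have in_ab c : c \in [set a; b] -> src c = v by rewrite -eq_ab inE => /eqP.
  by split; apply: in_ab; rewrite !inE eqxx ?orbT.
have /(factorP G2)/(_ a b) := facS; rewrite /twin neab src_a src_b eqxx /=.
by move=> /(_ isT); case: (boolP (a \in S)) => [aS _ | _ bS]; [exists a | exists b].
Qed.

Lemma nxt_exit v : is_exit v -> nxt S v = v.
Proof.
rewrite /nxt => exit_v; case: pickP => // a /andP[_ /eqP eq_v].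
by rewrite -eq_v (negPf (not_exit_src a)) in exit_v.
Qed.

Lemma iter_nxt_exit k v : is_exit v -> iter k (nxt S) v = v.
Proof. by move=> exit_v; elim: k => //= k ->; apply: nxt_exit. Qed.

Lemma nxt_not_entry v : ~~ is_exit v -> ~~ is_entry (nxt S v).
Proof. by case/factor_out=> a aS <-; rewrite nxt_src // not_entry_tgt. Qed.

Lemma nxt_inj : {in [pred v | ~~ is_exit v] &, injective (nxt S)}.
Proof.
move=> v w /factor_out[a aS <-] /factor_out[b bS <-]; rewrite !nxt_src //.
by move/(factor_tgt_inj aS bS) ->.
Qed.

(** A factor has exactly one arc out of each vertex that is not an exit, so [step S] is the graph of
    [nxt S] up to the fixed points at exits, which do not affect reachability. *)
Lemma connect_step : connect (step S) =2 fconnect (nxt S).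
Proof.
move=> x y; apply/idP/idP; apply: connect_sub => {}x {}y.
  case/existsP=> a /and3P[aS /eqP <- /eqP <-]; apply: connect1.
  by rewrite /= nxt_src.
move/eqP <-; case: (boolP (is_exit x)) => [/nxt_exit -> // | /factor_out[a aS <-]].
apply: connect1; apply/existsP; exists a.
by rewrite aS nxt_src // !eqxx.
Qed.

Lemma fconnect_exit x y z :
  is_exit y -> is_exit z -> fconnect (nxt S) x y -> fconnect (nxt S) x z -> y = z.
Proof.
move=> exit_y exit_z /iter_findex + /iter_findex.
set i := findex _ _ y; set j := findex _ _ z => eq_y eq_z.
have [le_ij | /ltnW le_ji] := leqP i j.
  by rewrite -eq_z -(subnK le_ij) iterD eq_y iter_nxt_exit.
by rewrite -eq_y -(subnK le_ji) iterD eq_z iter_nxt_exit.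
Qed.

Lemma fconnect_exit_first x y : is_exit y -> fconnect (nxt S) x y ->
  exists2 k, iter k (nxt S) x = y & forall j, j < k -> ~~ is_exit (iter j (nxt S) x).
Proof.
move=> exit_y con_xy.
have ex_k : exists k, is_exit (iter k (nxt S) x).
  by exists (findex (nxt S) x y); rewrite iter_findex.
exists (ex_minn ex_k); case: ex_minnP => k exit_k min_k.
  by apply: (fconnect_exit (x := x)); rewrite ?fconnect_iter.
by move=> j; apply: contraL => /min_k; rewrite -leqNgt.
Qed.

(** Injectivity of [nxt] off the exits lets both walks be retraced from [y] in parallel; if one
    ended before the other, an entry would be the successor of a vertex. *)
Lemma fconnect_entry_inj x x' y : is_entry x -> is_entry x' -> is_exit y ->
  fconnect (nxt S) x y -> fconnect (nxt S) x' y -> x = x'.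
Proof.
move=> entry_x entry_x' exit_y /(fconnect_exit_first exit_y)[k eq_k lt_k].
case/(fconnect_exit_first exit_y)=> k' eq_k'; rewrite -{}eq_k' in eq_k *.
elim: k lt_k k' eq_k => [|k IH] lt_k [|k'] //=.
- by move=> eq_x lt_k'; have := nxt_not_entry (lt_k' k' (leqnn _)); rewrite -eq_x entry_x.
- by move=> eq_x' _; have := nxt_not_entry (lt_k k (leqnn _)); rewrite eq_x' entry_x'.
move=> + lt_k'; move/nxt_inj; rewrite !inE lt_k // lt_k' // => /(_ isT isT) eq_k.
apply: (IH _ _ eq_k) => j lt_j; first by apply: lt_k; apply: leqW.
by apply: lt_k'; apply: leqW.
Qed.

(** Without exits, [nxt] is injective on the orbit of [x], so the walk returns to [x] itself and not
    merely to a later vertex. *)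
Lemma orbit_arcs_dicycle x :
  (forall y, fconnect (nxt S) x y -> ~~ is_exit y) -> orbit_arcs S x \in dicycles G.
Proof.
move=> no_exit; set f := nxt S; set m := fingraph.order f x.
have iter_m : iter m f x = x.
  apply: (@fingraph.iter_order_in _ f [pred y | fconnect f x y]); rewrite ?inE //.
    by move=> y; rewrite !inE => /connect_trans; apply; apply: fconnect1.
  by move=> y z; rewrite !inE => /no_exit ? /no_exit ?; apply: nxt_inj.
have [u uP] : exists u : 'I_m -> arcs G, forall i, u i \in S /\ src (u i) = iter i f x.
  apply: (fin_all_exists (P := fun i a => a \in S /\ src a = iter (i : 'I_m) f x)) => i.
  by have [a aS eq_a] := factor_out (no_exit _ (fconnect_iter f i x)); exists a.
have u_inj : injective (fun i => src (u i)).
  move=> i j; rewrite (uP i).2 (uP j).2 => eq_ij; apply/val_inj => /=.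
  by rewrite -(findex_iter (ltn_ord i)) eq_ij findex_iter.
have lt_m : m < #|arcs G|.+1.
  rewrite ltnS -[m]card_ord; apply: (@leq_card _ _ u) => i j eq_ij.
  by apply: u_inj; rewrite eq_ij.
rewrite inE; apply/existsP; exists (Ordinal lt_m); apply/existsP; exists (finfun u).
apply/andP; split.
  apply/and3P; split; first exact: fingraph.order_gt0.
    by apply/injectiveP=> i j; rewrite !ffunE; apply: u_inj.
  apply/forallP=> i; rewrite !ffunE -(nxt_src (uP i).1) (uP i).2 (uP _).2 -iterS.
  have [lt_i | ge_i] := ltnP i.+1 m; first by rewrite /= modn_small.
  have eq_i : i.+1 = m by apply/eqP; rewrite eqn_leq ge_i ltn_ord.
  by rewrite eq_i iter_m /= eq_i modnn.
apply/eqP/setP=> a; rewrite inE; apply/andP/imsetP => [[aS con_a] | [i _ ->]].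
  exists (Ordinal (findex_max con_a)) => //; rewrite ffunE.
  by apply: factor_src_inj; rewrite // ?(uP _).1 // (uP _).2 /= iter_findex.
by rewrite ffunE (uP i).1 (uP i).2 fconnect_iter.
Qed.

Lemma dicycle_orbit_arcs C : C \in dicycles G -> C \subset S ->
  exists2 x, C = orbit_arcs S x
           & forall y, fconnect (nxt S) x y -> exists2 a, a \in C & src a = y.
Proof.
rewrite inE => /existsP[[m lt_m] /existsP[/= e /andP[dic_e /eqP->]]].
case/and3P: dic_e => m_gt0 /injectiveP e_inj /forallP eP.
move=> /subsetP sCS; pose i0 := Ordinal m_gt0.
have eS i : e i \in S by apply/sCS/imset_f.
have iter_e k : exists i : 'I_m, iter k (nxt S) (src (e i0)) = src (e i).
  elim: k => [|k [i IH]]; first by exists i0.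
  by exists (ordS i); rewrite iterS IH nxt_src // (eqP (eP i)).
have con_e i : fconnect (nxt S) (src (e i0)) (src (e i)).
  case: i => k; elim: k => [|k IH] lt_k.
    by apply: eq_connect0; congr (src (e _)); apply/val_inj.
  apply: connect_trans (IH (ltnW lt_k)) _; apply: connect1; rewrite /= nxt_src // (eqP (eP _)).
  by apply/eqP; congr (src (e _)); apply/val_inj; rewrite /= modn_small.
exists (src (e i0)) => [|y /iter_findex <-]; last first.
  by have [i ->] := iter_e (findex (nxt S) (src (e i0)) y); exists (e i); rewrite ?imset_f.
apply/setP=> a; rewrite inE; apply/imsetP/andP => [[i _ ->] | [aS /iter_findex]].
  by rewrite eS con_e.
have [i ->] := iter_e (findex (nxt S) (src (e i0)) (src a)).
by move/(factor_src_inj (eS i) aS) <-; exists i.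
Qed.

(** A walk that avoids the exits closes up into a cycle, and a cycle inside [S] traps every walk
    that starts on it. *)
Lemma open_factorP :
  reflect (forall x, exists2 y, is_exit y & fconnect (nxt S) x y) (cycles_in S == set0).
Proof.
apply: (iffP eqP) => [no_cycle x | flow].
  apply/exists_inP; apply: contraT; rewrite negb_exists => /forallP no_exit.
  suff : orbit_arcs S x \in cycles_in S by rewrite no_cycle inE.
  rewrite inE orbit_arcs_dicycle; first by apply/subsetP=> a; rewrite inE => /andP[].
  by move=> y con_xy; have := no_exit y; rewrite con_xy andbT.
apply/eqP; rewrite -subset0; apply/subsetP=> C; rewrite inE => /andP[dicC sCS].
have [x _ outC] := dicycle_orbit_arcs dicC sCS.
have [y exit_y /outC[a _ eq_y]] := flow x.
by rewrite -eq_y (negPf (not_exit_src a)) in exit_y.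
Qed.

End Factor.

Section Saturated.
Hypothesis Gdd : is_2dd G.

Lemma no_exit v : ~~ is_exit v.
Proof. by case/andP: (Gdd v) => _ /eqP deg2; rewrite /is_exit deg2 andbF. Qed.

Variable S : {set arcs G}.
Hypothesis facS : is_factor S.

Lemma nxt_2dd_inj : injective (nxt S).
Proof. by move=> v w; apply: nxt_inj => //; rewrite inE no_exit. Qed.

Lemma cycles_in_2dd : cycles_in S = [set orbit_arcs S x | x : verts G].
Proof.
apply/setP=> C; rewrite inE; apply/andP/imsetP => [[dicC sCS] | [x _ ->]].
  by have [x eqC _] := dicycle_orbit_arcs facS dicC sCS; exists x.
split; first by apply: orbit_arcs_dicycle => // y _; apply: no_exit.
by apply/subsetP=> a; rewrite inE => /andP[].
Qed.

Lemma orbit_arcs_eq x y : (orbit_arcs S x == orbit_arcs S y) = fconnect (nxt S) x y.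
Proof.
apply/eqP/idP => [eq_xy | con_xy].
  have [a aS src_a] := factor_out facS (no_exit y).
  have : a \in orbit_arcs S y by rewrite inE aS src_a connect0.
  by rewrite -eq_xy inE src_a => /andP[].
apply/setP=> a; rewrite !inE; congr (_ && _).
by apply: same_connect con_xy _; apply/fconnect_sym/nxt_2dd_inj.
Qed.

End Saturated.

(** A cycle through all vertices uses exactly one of the two arcs leaving each vertex and one of the
    two entering it, which is the criterion of [factorP]. *)
Lemma spanning_dicycle_factor C : C \in dicycles G ->
  (forall v, exists2 a, a \in C & src a = v) -> is_factor C.
Proof.
rewrite inE => /existsP[[m lt_m] /existsP[/= e /andP[dic_e /eqP eqC]]] span.
case/and3P: dic_e => m_gt0 /injectiveP e_inj /forallP eP.
have eC i : e i \in C by rewrite eqC imset_f.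
have CP a : a \in C -> exists i, a = e i by rewrite eqC => /imsetP[i _ ->]; exists i.
have sepC f : (forall a, #|[set b | f b == f a]| = 2) -> {in C &, injective f} ->
    (forall v : verts G, exists2 a, a \in C & f a = v) ->
    forall a b, a != b -> f a = f b -> (b \in C) = ~~ (a \in C).
  move=> fib2 f_inj f_onto a b neab eq_ab; apply/idP/idP => [bC | naC].
    by apply: contra neab => aC; apply/eqP; apply: f_inj.
  have [c cC eq_c] := f_onto (f a).
  have neca : c != a by apply: contraNneq naC => <-.
  by rewrite -(fibre2_uniq fib2 neca _ eq_c (esym eq_ab)) // eq_sym.
apply/factorP => // a b /andP[neab /orP[]/eqP].
  apply: sepC => //; first exact: outfibre2.
  by move=> _ _ /CP[i ->] /CP[j ->] /e_inj ->.
apply: sepC => //; first exact: infibre2.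
  by move=> _ _ /CP[i ->] /CP[j ->]; rewrite (eqP (eP i)) (eqP (eP j)) => /e_inj/ordS_inj ->.
move=> v; have [_ /CP[i ->] <-] := span v; exists (e (ord_pred i)) => //.
by rewrite (eqP (eP _)) ord_predK.
Qed.

End Next.

Lemma saturated_2digraph G : is_2dd G -> is_2digraph G.
Proof. by move=> Gdd v; rewrite Gdd !orbT. Qed.

Lemma hamiltonian_factorP G : is_2dd G ->
  hamiltonian G <-> exists2 S : {set arcs G}, is_factor S & #|cycles_in S| = 1.
Proof.
move=> Gdd; have G2 := saturated_2digraph Gdd; split=> [[C dicC spanC] | [S facS]].
  have facC := spanning_dicycle_factor G2 dicC spanC; exists C => //.
  suff -> : cycles_in C = [set C] by rewrite cards1.
  have [z eqC conC] := dicycle_orbit_arcs G2 facC dicC (subxx _).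
  rewrite cycles_in_2dd //; apply/setP=> D; rewrite inE.
  apply/imsetP/eqP => [[y _ ->] | ->]; last by exists z.
  rewrite [RHS]eqC; apply/eqP; rewrite orbit_arcs_eq // fconnect_sym; last exact: nxt_2dd_inj.
  by have [a + <-] := spanC y; rewrite {1}eqC inE => /andP[].
move=> /eqP/cards1P[C eqC]; have : C \in cycles_in S by rewrite eqC inE.
rewrite inE => /andP[dicC sCS]; exists C => // v.
have : orbit_arcs S v \in cycles_in S by rewrite cycles_in_2dd // imset_f.
rewrite eqC inE => /eqP <-; have [a aS src_a] := factor_out G2 facS (no_exit Gdd v).
by exists a; rewrite // inE aS src_a connect0.
Qed.

(** * Gluing two 2-digraphs *)

(** Both images are the quotient of [T] by the same equivalence relation. This compares cycles of a
    factor with orbits of a permutation, which are sets over different types. *)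
Lemma card_imset_same_kernel (T U V : finType) (f : T -> U) (g : T -> V) :
  (forall x y, (f x == f y) = (g x == g y)) -> #|f @: T| = #|g @: T|.
Proof.
suff le (X Y : finType) (k : T -> X) (l : T -> Y) :
    (forall x y, (k x == k y) = (l x == l y)) -> #|k @: T| <= #|l @: T|.
  by move=> ker; apply/eqP; rewrite eqn_leq !le // => x y; rewrite ker.
(* [m] lifts a value of [l] to a chosen preimage and applies [k]; the option type caters for values
   outside the image. *)
move=> ker; pose m z := omap k [pick x | l x == z].
have -> : #|k @: T| = #|Some @: (k @: T)| by rewrite card_imset //; apply: Some_inj.
suff /subset_leq_card/leq_trans-> : Some @: (k @: T) \subset m @: (l @: T).
- by [].
- exact: leq_imset_card.
apply/subsetP=> _ /imsetP[_ /imsetP[x _ ->] ->]; apply/imsetP.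
exists (l x); rewrite ?imset_f // /m; case: pickP => [y | /(_ x)]; last by rewrite eqxx.
by rewrite -ker => /eqP /= ->.
Qed.

Lemma labelling_mem H n (A : {set verts H}) (l : 'I_n -> verts H) i :
  labelling A l -> l i \in A.
Proof. by case=> _ <-; apply: imset_f. Qed.

Lemma labelling_onto H n (A : {set verts H}) (l : 'I_n -> verts H) v :
  labelling A l -> v \in A -> exists i, v = l i.
Proof. by case=> _ <- /imsetP[i _ ->]; exists i. Qed.

Lemma open_route H n (S : {set arcs H}) (li lo : 'I_n -> verts H) :
    is_2digraph H -> labelling (entries H) li -> labelling (exits H) lo ->
    is_factor S -> cycles_in S = set0 ->
  exists p : 'S_n, forall i, connect (step S) (li i) (lo (p i)).
Proof.
move=> H2 lab_li lab_lo facS /eqP/open_factorP flow.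
have entry_li i : is_entry (li i).
  by have := labelling_mem i lab_li; rewrite inE.
have exit_lo i : is_exit (lo i).
  by have := labelling_mem i lab_lo; rewrite inE.
have [p pP] : exists p : 'I_n -> 'I_n, forall i, fconnect (nxt S) (li i) (lo (p i)).
  apply: (fin_all_exists (P := fun i j => fconnect (nxt S) (li i) (lo j))) => i.
  have [y exit_y con] := flow H2 facS (li i).
  have [|j eq_y] := labelling_onto lab_lo (_ : y \in _); first by rewrite inE.
  by exists j; rewrite -eq_y.
have p_inj : injective p.
  move=> i j eq_p; apply: lab_li.1.
  by apply: (fconnect_entry_inj H2 facS _ _ (exit_lo (p i))); rewrite ?entry_li // eq_p.
by exists (perm p_inj) => i; rewrite permE connect_step.
Qed.

Lemma open_routes_neq0 H n (li lo : 'I_n -> verts H) :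
    is_2digraph H -> is_open H -> labelling (entries H) li -> labelling (exits H) lo ->
  open_routes li lo != set0.
Proof.
move=> H2 [S openS] lab_li lab_lo; have /andP[facS /eqP no_cycle] := openS.
have [p pP] := open_route H2 lab_li lab_lo facS no_cycle.
apply/set0Pn; exists p; rewrite inE; apply/existsP; exists S; rewrite openS.
exact/forallP.
Qed.

(** * Embeddings and first-return maps *)

(** Incidence is preserved but degrees need not be: an exit of [H] may acquire outgoing arcs in [G].
    This covers both a subgraph in its 2-dd and a part in a gluing. *)
Record embedding H G (f : verts H -> verts G) (h : arcs H -> arcs G) : Prop := Embedding {
  emb_verts_inj : injective f;
  emb_arcs_inj : injective h;
  emb_src : forall a, src (h a) = f (src a);
  emb_tgt : forall a, tgt (h a) = f (tgt a)
}.

Section EmbeddingTheory.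
Variables (H G : digraph) (f : verts H -> verts G) (h : arcs H -> arcs G).
Hypotheses (H2 : is_2digraph H) (G2 : is_2digraph G) (emb : embedding f h).

Lemma twin_emb a b : twin (h a) (h b) = twin a b.
Proof.
have [f_inj h_inj hsrc htgt] := emb.
by rewrite /twin !hsrc !htgt (inj_eq f_inj) (inj_eq f_inj) (inj_eq h_inj).
Qed.

(** The twins of [a] in [H] already fill the two-element fibres of [h a] in [G]. Hence an embedding
    carries ACs onto whole ACs. *)
Lemma twin_emb_closed a c : twin (h a) c -> exists b, c = h b.
Proof.
have [f_inj h_inj hsrc htgt] := emb.
case/andP; rewrite eq_sym => neca /orP[]/eqP eq_ac.
  have [neb src_b] := mateP (outfibre2 H2) a; exists (mate (@src H) a).
  apply: (fibre2_uniq (outfibre2 G2) neca); rewrite // ?(inj_eq h_inj) //.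
  by rewrite !hsrc src_b.
have [neb tgt_b] := mateP (infibre2 H2) a; exists (mate (@tgt H) a).
apply: (fibre2_uniq (infibre2 G2) neca); rewrite // ?(inj_eq h_inj) //.
by rewrite !htgt tgt_b.
Qed.

Lemma card_component_emb a :
  #|[set c | connect twin (h a) c]| = #|[set b | connect twin a b]|.
Proof.
rewrite -(card_imset (mem [set b | connect twin a b]) (emb_arcs_inj emb)).
congr #|pred_of_set _|; apply/setP=> c; rewrite inE; apply/idP/imsetP => [/connectP[p] | [b]].
  elim: p a => [|d p IH] a /=; first by move=> _ ->; exists a; rewrite ?inE.
  case/andP=> tw; have [b eq_d] := twin_emb_closed tw; rewrite {d}eq_d twin_emb in tw *.
  move=> path_p /(IH _ path_p)[d]; rewrite inE => con ->; exists d => //.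
  by rewrite inE (connect_trans _ con) ?connect1.
rewrite inE => /connectP[p + ->] ->; elim: p a => [|d p IH] a //= /andP[tw /IH].
by apply: connect_trans; rewrite connect1 ?twin_emb.
Qed.

Variable S : {set arcs G}.
Hypothesis facS : is_factor S.

Lemma preim_factor : is_factor (h @^-1: S).
Proof.
apply/factorP=> // a b; rewrite -twin_emb !inE => tw.
by have /(factorP G2)/(_ _ _ tw) := facS.
Qed.

(** Exits are excluded because there the walk in [H] halts while the one in [G] may go on. *)
Lemma nxt_emb x : ~~ is_exit x -> nxt S (f x) = f (nxt (h @^-1: S) x).
Proof.
case/(factor_out H2 preim_factor) => a aS <-.
rewrite (nxt_src H2 preim_factor aS) -(emb_src emb) -(emb_tgt emb).
by apply: nxt_src => //; rewrite inE in aS.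
Qed.

Lemma iter_nxt_emb k x :
    (forall j, j < k -> ~~ is_exit (iter j (nxt (h @^-1: S)) x)) ->
  iter k (nxt S) (f x) = f (iter k (nxt (h @^-1: S)) x).
Proof.
elim: k => //= k IH no_exit; rewrite IH; first by rewrite nxt_emb // no_exit.
by move=> j lt_j; apply: no_exit; apply: leqW.
Qed.

(** One crossing of a part. That its inner vertices are neither entries nor exits is what rules out
    an early return in [first_return]. *)
Lemma emb_passage x y : is_entry x -> is_exit y -> fconnect (nxt (h @^-1: S)) x y ->
  exists k, [/\ 0 < k, iter k (nxt S) (f x) = f y
    & forall j, 0 < j < k -> exists z,
        [/\ iter j (nxt S) (f x) = f z, ~~ is_entry z & ~~ is_exit z]].
Proof.
move=> entry_x exit_y /(fconnect_exit_first exit_y)[k eq_k no_exit].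
exists k; split.
- case: k eq_k {no_exit} => //= eq_k.
  by rewrite -eq_k (negPf (entry_not_exit entry_x)) in exit_y.
- by rewrite iter_nxt_emb // eq_k.
case=> // j lt_j; exists (iter j.+1 (nxt (h @^-1: S)) x); split.
- by apply: iter_nxt_emb => i lt_i; apply: no_exit; lia.
- by apply: (nxt_not_entry H2 preim_factor); apply: no_exit; lia.
- by apply: no_exit; lia.
Qed.

End EmbeddingTheory.

(** The only cycle of [S] reaches [f y] from every vertex; a walk in [H] that avoided the exits
    would be copied step by step in [G] and never come to [f y]. *)
Lemma emb_open H G (f : verts H -> verts G) (h : arcs H -> arcs G) S (y : verts H) :
    is_2digraph H -> is_2dd G -> embedding f h -> is_factor S -> #|cycles_in S| = 1 ->
  is_exit y -> cycles_in (h @^-1: S) = set0.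
Proof.
move=> H2 Gdd emb facS one_cycle exit_y; have G2 := saturated_2digraph Gdd.
apply/eqP/open_factorP => //; first exact: (preim_factor H2 G2 emb).
move=> x; apply/exists_inP; apply: contraT; rewrite negb_exists => /forallP no_exit.
have : fconnect (nxt S) (f x) (f y).
  rewrite -orbit_arcs_eq //; move/eqP/cards1P: one_cycle => [C eqC].
  have : orbit_arcs S (f x) \in cycles_in S by rewrite cycles_in_2dd // imset_f.
  have : orbit_arcs S (f y) \in cycles_in S by rewrite cycles_in_2dd // imset_f.
  by rewrite eqC !inE => /eqP -> /eqP ->.
move/iter_findex; rewrite (iter_nxt_emb H2 G2 emb facS).
  move/(emb_verts_inj emb) => eq_y; have := no_exit y.
  by rewrite exit_y -eq_y fconnect_iter.
by move=> j _; have := no_exit (iter j (nxt (h @^-1: S)) x); rewrite fconnect_iter andbT.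
Qed.

(* The exits of each part are the entries of the other; [p * q] is then the
   first-return map of a factor with routes p and q to the entries of H1. *)
Record gluing G H1 H2 n (f1 : verts H1 -> verts G) (h1 : arcs H1 -> arcs G)
    (f2 : verts H2 -> verts G) (h2 : arcs H2 -> arcs G)
    (li1 lo1 : 'I_n -> verts H1) (li2 lo2 : 'I_n -> verts H2) : Prop := Gluing {
  glu_2dd : is_2dd G;
  glu_2digraph1 : is_2digraph H1;
  glu_2digraph2 : is_2digraph H2;
  glu_emb1 : embedding f1 h1;
  glu_emb2 : embedding f2 h2;
  glu_disjoint : forall a b, h1 a != h2 b;
  glu_cover : forall c, (exists a, c = h1 a) \/ (exists b, c = h2 b);
  glu_li1 : labelling (entries H1) li1;
  glu_lo1 : labelling (exits H1) lo1;
  glu_li2 : labelling (entries H2) li2;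
  glu_lo2 : labelling (exits H2) lo2;
  glu_12 : forall i, f1 (lo1 i) = f2 (li2 i);
  glu_21 : forall i, f2 (lo2 i) = f1 (li1 i)
}.

Section GluingTheory.
Variables (G H1 H2 : digraph) (n : nat).
Variables (f1 : verts H1 -> verts G) (h1 : arcs H1 -> arcs G).
Variables (f2 : verts H2 -> verts G) (h2 : arcs H2 -> arcs G).
Variables (li1 lo1 : 'I_n -> verts H1) (li2 lo2 : 'I_n -> verts H2).
Hypothesis glu : gluing f1 h1 f2 h2 li1 lo1 li2 lo2.

Let Gdd := glu_2dd glu.
Let G_2 := saturated_2digraph Gdd.
Let H1_2 := glu_2digraph1 glu.
Let H2_2 := glu_2digraph2 glu.
Let emb1 := glu_emb1 glu.
Let emb2 := glu_emb2 glu.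
Let f1_inj := emb_verts_inj emb1.
Let f2_inj := emb_verts_inj emb2.

Let entry1 i : is_entry (li1 i).
Proof. by have := labelling_mem i (glu_li1 glu); rewrite inE. Qed.
Let entry2 i : is_entry (li2 i).
Proof. by have := labelling_mem i (glu_li2 glu); rewrite inE. Qed.
Let exit1 i : is_exit (lo1 i).
Proof. by have := labelling_mem i (glu_lo1 glu); rewrite inE. Qed.
Let exit2 i : is_exit (lo2 i).
Proof. by have := labelling_mem i (glu_lo2 glu); rewrite inE. Qed.

Let L i := f1 (li1 i).
Let L_inj : injective L.
Proof. by move=> i j /f1_inj /(glu_li1 glu).1. Qed.

Section GluedFactor.
Variable S : {set arcs G}.
Let S1 := h1 @^-1: S.
Let S2 := h2 @^-1: S.
Variables p q : 'S_n.
Hypotheses (facS : is_factor S) (open1 : cycles_in S1 = set0) (open2 : cycles_in S2 = set0).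
Hypothesis routep : forall i, connect (step S1) (li1 i) (lo1 (p i)).
Hypothesis routeq : forall i, connect (step S2) (li2 i) (lo2 (q i)).

Let facS1 : is_factor S1 := preim_factor H1_2 G_2 emb1 facS.
Let facS2 : is_factor S2 := preim_factor H2_2 G_2 emb2 facS.

Let first_return i : exists m,
  [/\ 0 < m, iter m (nxt S) (L i) = L ((p * q)%g i)
    & forall j i', 0 < j < m -> iter j (nxt S) (L i) <> L i'].
Proof.
have := routep i; rewrite connect_step //.
case/(emb_passage H1_2 G_2 emb1 facS (entry1 i) (exit1 _)) => k1 [k1_gt0 eq1 mid1].
have := routeq (p i); rewrite connect_step //.
case/(emb_passage H2_2 G_2 emb2 facS (entry2 _) (exit2 _)) => k2 [k2_gt0 eq2 mid2].
have iter_k1 j : iter (j + k1) (nxt S) (L i) = iter j (nxt S) (f2 (li2 (p i))).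
  by rewrite iterD eq1 (glu_12 glu).
exists (k2 + k1); split; first by rewrite addn_gt0 k2_gt0.
  by rewrite iter_k1 eq2 (glu_21 glu) permM.
(* The intermediate vertex is inside the first part, inside the second, or at the junction. Since
   [L i'] is both an entry of the first part and an exit of the second, each case is excluded by
   injectivity of [f1] or [f2]. *)
move=> j i' /andP[j_gt0 lt_j]; case: (ltngtP j k1) => [lt_jk | gt_jk | ->].
- have [|z [-> nentry _] /f1_inj eq_z] := mid1 j; first by rewrite j_gt0.
  by rewrite eq_z entry1 in nentry.
- rewrite -(subnK (ltnW gt_jk)) iter_k1.
  have [|z [-> _ nexit]] := mid2 (j - k1); first by lia.
  by rewrite /L -(glu_21 glu) => /f2_inj eq_z; rewrite eq_z exit2 in nexit.
by rewrite eq1 => /f1_inj eq_lo; have := entry_not_exit (entry1 i'); rewrite -eq_lo exit1.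
Qed.

Let fconnect_L i j : fconnect (nxt S) (L i) (L j) = (porbit (p * q) i == porbit (p * q) j).
Proof.
apply/idP/eqP => [/iter_findex | eq_ij].
  move: (findex _ _ _) => k; elim/ltn_ind: k i => -[_ i /L_inj -> //|k IH i eq_k].
  have [m [m_gt0 eq_m mid]] := first_return i.
  (* A walk that ends at some [L j] cannot stop before the first return; cutting off that return
     replaces [i] by its image under [p * q]. *)
  have [lt_km | le_mk] := ltnP k.+1 m; first by case: (mid k.+1 j lt_km eq_k).
  rewrite -(porbit_perm _ 1) expg1; apply: (IH (k.+1 - m)); first by lia.
  by rewrite -eq_m -iterD subnK.
have /porbitP[k ->] : j \in porbit (p * q) i by rewrite eq_ij porbit_id.
rewrite permX; elim: k => //= k IH; apply: connect_trans IH _.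
by have [m [_ <- _]] := first_return (iter k (p * q)%g i); apply: fconnect_iter.
Qed.

(** Neither part contains a cycle, so a walk leaves the first part into the second, and the second
    at an entry of the first. Thus no cycle of [S] escapes the count by orbits. *)
Let reach_L v : exists i, fconnect (nxt S) v (L i).
Proof.
have emb_reach H f h (emb : @embedding H G f h) x : is_2digraph H ->
    cycles_in (h @^-1: S) = set0 ->
    exists2 y, is_exit y & fconnect (nxt S) (f x) (f y).
  move=> H_2 /eqP open; have facSh := preim_factor H_2 G_2 emb facS.
  have [y exit_y] := open_factorP H_2 facSh open x.
  case/(fconnect_exit_first exit_y)=> k eq_k no_exit.
  exists y => //; rewrite -eq_k -(iter_nxt_emb H_2 G_2 emb facS no_exit).
  exact: fconnect_iter.
have reach2 x : exists i, fconnect (nxt S) (f2 x) (L i).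
  have [y exit_y con] := emb_reach _ _ _ emb2 x H2_2 open2.
  have [|i eq_y] := labelling_onto (glu_lo2 glu) (_ : y \in _); first by rewrite inE.
  by exists i; rewrite /L -(glu_21 glu) -eq_y.
(* [glu_cover] locates arcs and not vertices, so [v] is treated as the source of an arc of [S]. *)
have [a _ <-] := factor_out G_2 facS (no_exit Gdd v).
case: (glu_cover glu a) => [[b ->] | [b ->]]; last by rewrite (emb_src emb2).
rewrite (emb_src emb1); have [y exit_y con] := emb_reach _ _ _ emb1 (src b) H1_2 open1.
have [|i eq_y] := labelling_onto (glu_lo1 glu) (_ : y \in _); first by rewrite inE.
have [j con'] := reach2 (li2 i); exists j; apply: connect_trans con _.
by rewrite eq_y (glu_12 glu).
Qed.

Lemma card_cycles_glued : #|cycles_in S| = #|porbits (p * q)|.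
Proof.
have -> : cycles_in S = (fun i => orbit_arcs S (L i)) @: 'I_n.
  rewrite cycles_in_2dd //; apply/setP=> C; apply/imsetP/imsetP => [[v _ ->] | [i _ ->]].
    have [i con] := reach_L v; exists i => //.
    by apply/eqP; rewrite orbit_arcs_eq.
  by exists (L i).
by apply: card_imset_same_kernel => i j; rewrite orbit_arcs_eq // fconnect_L.
Qed.

End GluedFactor.

(** By [twin_emb_closed] no pair of twins straddles the two parts, so the choices made in them are
    independent. *)
Lemma glued_factor S1 S2 : is_factor S1 -> is_factor S2 ->
  exists S, [/\ is_factor S, h1 @^-1: S = S1 & h2 @^-1: S = S2].
Proof.
move=> facS1 facS2; pose S := h1 @: S1 :|: h2 @: S2.
have S_h1 a : (h1 a \in S) = (a \in S1).
  rewrite inE mem_imset; last exact: emb_arcs_inj emb1.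
  rewrite orb_idr // => /imsetP[b _ eq_ab].
  by have := glu_disjoint glu a b; rewrite eq_ab eqxx.
have S_h2 b : (h2 b \in S) = (b \in S2).
  rewrite inE [_ \in h2 @: _]mem_imset; last exact: emb_arcs_inj emb2.
  rewrite orb_idl // => /imsetP[a _ eq_ba].
  by have := glu_disjoint glu a b; rewrite eq_ba eqxx.
exists S; split; first last.
- by apply/setP=> b; rewrite inE S_h2.
- by apply/setP=> a; rewrite inE S_h1.
apply/factorP=> // c d tw; case: (glu_cover glu c) => [[a eq_c] | [b eq_c]]; subst c.
  have [b eq_d] := twin_emb_closed H1_2 G_2 emb1 tw; subst d.
  by rewrite !S_h1; have /(factorP H1_2) := facS1; apply; rewrite -(twin_emb emb1).
have [a eq_d] := twin_emb_closed H2_2 G_2 emb2 tw; subst d.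
by rewrite !S_h2; have /(factorP H2_2) := facS2; apply; rewrite -(twin_emb emb2).
Qed.

Lemma glued_routes p q : p \in open_routes li1 lo1 -> q \in open_routes li2 lo2 ->
  exists2 S : {set arcs G}, is_factor S & #|cycles_in S| = #|porbits (p * q)|.
Proof.
rewrite !inE => /existsP[S1 /andP[/andP[facS1 /eqP open1] /forallP routep]].
case/existsP=> [S2 /andP[/andP[facS2 /eqP open2] /forallP routeq]].
have [S [facS eq1 eq2]] := glued_factor facS1 facS2; subst S1 S2.
by exists S => //; apply: card_cycles_glued.
Qed.

Lemma glued_hamiltonian : 0 < n ->
  hamiltonian G <-> exists p q, [/\ p \in open_routes li1 lo1, q \in open_routes li2 lo2
    & (p * q)%g \in full_cycles n].
Proof.
(* [i0] labels an exit of each part, as [emb_open] requires. *)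
move=> n_gt0; pose i0 := Ordinal n_gt0; split.
  case/(hamiltonian_factorP Gdd) => S facS one_cycle.
  have open1 := emb_open H1_2 Gdd emb1 facS one_cycle (exit1 i0).
  have open2 := emb_open H2_2 Gdd emb2 facS one_cycle (exit2 i0).
  have facS1 := preim_factor H1_2 G_2 emb1 facS.
  have facS2 := preim_factor H2_2 G_2 emb2 facS.
  have [p routep] := open_route H1_2 (glu_li1 glu) (glu_lo1 glu) facS1 open1.
  have [q routeq] := open_route H2_2 (glu_li2 glu) (glu_lo2 glu) facS2 open2.
  exists p, q; split.
  - rewrite inE; apply/existsP; exists (h1 @^-1: S).
    by rewrite /is_open_factor facS1 open1 eqxx; apply/forallP.
  - rewrite inE; apply/existsP; exists (h2 @^-1: S).
    by rewrite /is_open_factor facS2 open2 eqxx; apply/forallP.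
  by rewrite inE -(card_cycles_glued facS open1 open2 routep routeq) one_cycle.
case=> p [q [rp rq]]; rewrite inE => /eqP one_orbit.
apply/(hamiltonian_factorP Gdd); have [S facS eqS] := glued_routes rp rq.
by exists S; rewrite // eqS.
Qed.

End GluingTheory.

(** * Subgraphs, replacement and residues *)

(** Needed because an entry of a subgraph and the same vertex as an exit of the complement are terms
    of different types, compared only through their images in [V]. *)
Lemma labelling_transport (V : Type) H1 H2 n (f1 : verts H1 -> V) (f2 : verts H2 -> V)
    (A1 : {set verts H1}) (A2 : {set verts H2}) (l1 : 'I_n -> verts H1) :
    injective f1 -> injective f2 ->
    (forall x, x \in A1 -> exists2 y, y \in A2 & f2 y = f1 x) ->
    (forall y, y \in A2 -> exists2 x, x \in A1 & f1 x = f2 y) ->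
    labelling A1 l1 ->
  exists2 l2 : 'I_n -> verts H2, labelling A2 l2 & forall i, f2 (l2 i) = f1 (l1 i).
Proof.
move=> f1_inj f2_inj A12 A21 lab1.
have [l2 l2P] : exists l2 : 'I_n -> verts H2, forall i, l2 i \in A2 /\ f2 (l2 i) = f1 (l1 i).
  apply: (fin_all_exists (P := fun i y => y \in A2 /\ f2 y = f1 (l1 i))) => i.
  by have [y A2y eq_y] := A12 _ (labelling_mem i lab1); exists y.
exists l2 => [|i]; last exact: (l2P i).2.
split=> [i j eq_l|].
  by apply/lab1.1/f1_inj; rewrite -(l2P i).2 -(l2P j).2 eq_l.
apply/setP=> y; apply/imsetP/idP => [[i _ ->] | A2y]; first exact: (l2P i).1.
have [x /(labelling_onto lab1)[i ->] eq_y] := A21 y A2y; exists i => //.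
by apply: f2_inj; rewrite (l2P i).2.
Qed.

Lemma labelled_bijection H1 H2 n (P1 : pred (verts H1)) (P2 : pred (verts H2))
    (l1 : 'I_n -> verts H1) (l2 : 'I_n -> verts H2) :
    labelling [set v | P1 v] l1 -> labelling [set v | P2 v] l2 ->
  exists2 phi : {v | P1 v} -> {v | P2 v}, bijective phi
    & forall i w, val w = l1 i -> val (phi w) = l2 i.
Proof.
have half H H' (P : pred (verts H)) (P' : pred (verts H'))
    (l : 'I_n -> verts H) (l' : 'I_n -> verts H') :
    labelling [set v | P v] l -> labelling [set v | P' v] l' ->
  exists2 phi : {v | P v} -> {v | P' v}, injective phi
    & forall i w, val w = l i -> val (phi w) = l' i.
  move=> lab lab'.
  have [phi phiP] : exists phi : {v | P v} -> {v | P' v},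
      forall w, exists i, val w = l i /\ val (phi w) = l' i.
    apply: (fin_all_exists (P := fun w w' => exists i, val w = l i /\ val w' = l' i)).
    case=> v Pv /=; have [|i eq_v] := labelling_onto lab (_ : v \in _); first by rewrite inE.
    have P'i : P' (l' i) by have := labelling_mem i lab'; rewrite inE.
    by exists (exist (fun v => P' v) _ P'i), i.
  exists phi => [w1 w2 eq_phi | i w eq_w].
    have [i [eq_i eq_i']] := phiP w1; have [j [eq_j eq_j']] := phiP w2.
    apply/val_inj; rewrite eq_i eq_j; congr l; apply: lab'.1.
    by rewrite -eq_i' -eq_j' eq_phi.
  have [j [eq_j ->]] := phiP w; congr l'; apply: lab.1.
  by rewrite -eq_w -eq_j.
move=> lab1 lab2; have [phi phi_inj phiP] := half _ _ _ _ _ _ lab1 lab2.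
(* This injection supplies the cardinality bound that makes [phi] bijective. *)
have [psi psi_inj _] := half _ _ _ _ _ _ lab2 lab1.
by exists phi => //; apply: inj_card_bij => //; apply: leq_card psi_inj.
Qed.

(** With products read from left to right, [u] turns a new entry label into an old one and [w] an
    old exit label into a new one, whence the inverse in the exit labelling. *)
Lemma open_routes_relabel H n (li lo : 'I_n -> verts H) (u w p : 'S_n) :
  (u * p * w \in open_routes (li \o u) (lo \o w^-1))%g = (p \in open_routes li lo).
Proof.
rewrite !inE; apply: eq_existsb => S; congr (_ && _).
apply/forallP/forallP => /= routes i; last by rewrite !permM permK.
by have := routes ((u^-1)%g i); rewrite !permM permKV permK.
Qed.

(** * Entries and exits of a subgraph and of its complement *)

Section Subgraphs.
Variables (G : digraph) (K : {set {set arcs G}}).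
Hypotheses (Gdd : is_2dd G) (sKA : K \subset ACs G).

Let G2 := saturated_2digraph Gdd.

Lemma subgraph_embedding : embedding (H := subgraph K) (G := G) val val.
Proof. by split=> //; apply: val_inj. Qed.

Definition in_cover v := [exists a in cover K, tgt a == v].
Definition out_cover v := [exists a in cover K, src a == v].

(** The two arcs entering [v] are twins, so they lie in the same AC and [K] covers both or
    neither. *)
Lemma in_coverP v : reflect (forall a, tgt a = v -> a \in cover K) (in_cover v).
Proof.
apply: (iffP exists_inP) => [[b bU /eqP tgt_b] a tgt_a | all_in].
  have [-> // | neab] := eqVneq a b.
  by rewrite (cover_closed G2 sKA (_ : twin a b)) // /twin neab tgt_a tgt_b eqxx orbT.
have /andP[/eqP deg2 _] := Gdd v.
have /card_gt0P[a] : 0 < indeg v by rewrite deg2.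
by rewrite inE => /eqP tgt_a; exists a; [apply: all_in | apply/eqP].
Qed.

Lemma out_coverP v : reflect (forall a, src a = v -> a \in cover K) (out_cover v).
Proof.
apply: (iffP exists_inP) => [[b bU /eqP src_b] a src_a | all_in].
  have [-> // | neab] := eqVneq a b.
  by rewrite (cover_closed G2 sKA (_ : twin a b)) // /twin neab src_a src_b eqxx.
have /andP[_ /eqP deg2] := Gdd v.
have /card_gt0P[a] : 0 < outdeg v by rewrite deg2.
by rewrite inE => /eqP src_a; exists a; [apply: all_in | apply/eqP].
Qed.

Lemma sub_vertE v : sub_vert K v = in_cover v || out_cover v.
Proof.
apply/exists_inP/orP => [[a aU /orP[]] | [] /exists_inP[a aU eq_v]].
- by right; apply/exists_inP; exists a.
- by left; apply/exists_inP; exists a.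
- by exists a; rewrite ?eq_v ?orbT.
- by exists a; rewrite ?eq_v ?orbT.
Qed.

Lemma indeg_subgraph (w : verts (subgraph K)) : indeg w = (in_cover (val w)).*2.
Proof.
have -> : indeg w = #|[set a in cover K | tgt a == val w]|.
  rewrite /indeg -(card_imset _ (emb_arcs_inj subgraph_embedding)).
  apply: eq_card => a; rewrite inE; apply/imsetP/andP.
    by case=> b; rewrite inE => /eqP <- ->; split; first exact: (valP b).
  by case=> aU /eqP tgt_a; exists (exist _ a aU); rewrite // inE; apply/eqP/val_inj.
case: in_coverP => [all_in | not_all].
  have /andP[/eqP deg2 _] := Gdd (val w); rewrite -[RHS]deg2.
  apply: eq_card => a; rewrite !inE andb_idl // => /eqP.
  exact: all_in.
apply/eqP; rewrite cards_eq0; apply/eqP/setP=> a; rewrite !inE.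
apply/negP=> /andP[aU tgt_a]; case: not_all; apply/in_coverP.
by apply/exists_inP; exists a.
Qed.

Lemma outdeg_subgraph (w : verts (subgraph K)) : outdeg w = (out_cover (val w)).*2.
Proof.
have -> : outdeg w = #|[set a in cover K | src a == val w]|.
  rewrite /outdeg -(card_imset _ (emb_arcs_inj subgraph_embedding)).
  apply: eq_card => a; rewrite inE; apply/imsetP/andP.
    by case=> b; rewrite inE => /eqP <- ->; split; first exact: (valP b).
  by case=> aU /eqP src_a; exists (exist _ a aU); rewrite // inE; apply/eqP/val_inj.
case: out_coverP => [all_in | not_all].
  have /andP[_ /eqP deg2] := Gdd (val w); rewrite -[RHS]deg2.
  apply: eq_card => a; rewrite !inE andb_idl // => /eqP.
  exact: all_in.
apply/eqP; rewrite cards_eq0; apply/eqP/setP=> a; rewrite !inE.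
apply/negP=> /andP[aU src_a]; case: not_all; apply/out_coverP.
by apply/exists_inP; exists a.
Qed.

Lemma is_entry_subgraph (w : verts (subgraph K)) :
  is_entry w = ~~ in_cover (val w) && out_cover (val w).
Proof. by rewrite /is_entry indeg_subgraph outdeg_subgraph; do 2 case: (_ (val w)). Qed.

Lemma is_exit_subgraph (w : verts (subgraph K)) :
  is_exit w = in_cover (val w) && ~~ out_cover (val w).
Proof. by rewrite /is_exit indeg_subgraph outdeg_subgraph; do 2 case: (_ (val w)). Qed.

Lemma subgraph_2digraph : is_2digraph (subgraph K).
Proof.
move=> w; rewrite is_entry_subgraph is_exit_subgraph /is_saturated.
rewrite indeg_subgraph outdeg_subgraph.
have := valP w; rewrite /= sub_vertE.
by case: (in_cover _); case: (out_cover _).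
Qed.

End Subgraphs.

Section Complement.
Variables (G : digraph) (K : {set {set arcs G}}).
Hypotheses (Gdd : is_2dd G) (sKA : K \subset ACs G).

Let G2 := saturated_2digraph Gdd.
Let sK'A : ACs G :\: K \subset ACs G := subsetDl _ _.

Lemma in_cover_compl v : in_cover (ACs G :\: K) v = ~~ in_cover K v.
Proof.
apply/exists_inP/idP => [[a] | /existsPn no_in].
  rewrite cover_compl // => aNU /eqP tgt_a; apply: contra aNU.
  by move/(in_coverP Gdd sKA)/(_ a tgt_a).
have /andP[/eqP deg2 _] := Gdd v.
have /card_gt0P[a] : 0 < indeg v by rewrite deg2.
rewrite inE => tgt_a; exists a; rewrite // cover_compl //.
by have := no_in a; rewrite tgt_a andbT.
Qed.

Lemma out_cover_compl v : out_cover (ACs G :\: K) v = ~~ out_cover K v.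
Proof.
apply/exists_inP/idP => [[a] | /existsPn no_out].
  rewrite cover_compl // => aNU /eqP src_a; apply: contra aNU.
  by move/(out_coverP Gdd sKA)/(_ a src_a).
have /andP[_ /eqP deg2] := Gdd v.
have /card_gt0P[a] : 0 < outdeg v by rewrite deg2.
rewrite inE => src_a; exists a; rewrite // cover_compl //.
by have := no_out a; rewrite src_a andbT.
Qed.

Lemma complement_labellings n (li lo : 'I_n -> verts (subgraph K)) :
    labelling (entries (subgraph K)) li -> labelling (exits (subgraph K)) lo ->
  exists li' lo' : 'I_n -> verts (complement K),
    [/\ labelling (entries (complement K)) li', labelling (exits (complement K)) lo',
        forall i, val (li' i) = val (lo i) & forall i, val (lo' i) = val (li i)].
Proof.
move=> lab_li lab_lo.
pose vK : verts (subgraph K) -> verts G := val.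
pose vK' : verts (complement K) -> verts G := val.
have [| | | |li' lab_li' eq_li'] :=
    @labelling_transport _ _ _ n vK vK' _ (entries (complement K)) _ _ _ _ _ lab_lo.
- exact: val_inj.
- exact: val_inj.
- move=> v; rewrite inE is_exit_subgraph // => /andP[in_v out_v].
  have sub_v : sub_vert (ACs G :\: K) (val v) by rewrite sub_vertE out_cover_compl out_v orbT.
  exists (exist (fun x => sub_vert _ x) _ sub_v) => //.
  by rewrite inE is_entry_subgraph //= in_cover_compl out_cover_compl in_v.
- move=> v; rewrite inE is_entry_subgraph // in_cover_compl out_cover_compl negbK.
  move=> /andP[in_v out_v].
  have sub_v : sub_vert K (val v) by rewrite sub_vertE in_v.
  exists (exist (fun x => sub_vert _ x) _ sub_v) => //.
  by rewrite inE is_exit_subgraph //= in_v.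
have [| | | |lo' lab_lo' eq_lo'] :=
    @labelling_transport _ _ _ n vK vK' _ (exits (complement K)) _ _ _ _ _ lab_li.
- exact: val_inj.
- exact: val_inj.
- move=> v; rewrite inE is_entry_subgraph // => /andP[in_v out_v].
  have sub_v : sub_vert (ACs G :\: K) (val v) by rewrite sub_vertE in_cover_compl in_v.
  exists (exist (fun x => sub_vert _ x) _ sub_v) => //.
  by rewrite inE is_exit_subgraph //= in_cover_compl out_cover_compl in_v out_v.
- move=> v; rewrite inE is_exit_subgraph // in_cover_compl out_cover_compl negbK.
  move=> /andP[in_v out_v].
  have sub_v : sub_vert K (val v) by rewrite sub_vertE out_v orbT.
  exists (exist (fun x => sub_vert _ x) _ sub_v) => //.
  by rewrite inE is_entry_subgraph //= in_v.
by exists li', lo'.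
Qed.

(** [G] itself is presented as a gluing, so that [glued_hamiltonian] applies to it as well as to the
    2-dd obtained by replacement. *)
Lemma subgraph_gluing n (li lo : 'I_n -> verts (subgraph K))
    (li' lo' : 'I_n -> verts (complement K)) :
    labelling (entries (subgraph K)) li -> labelling (exits (subgraph K)) lo ->
    labelling (entries (complement K)) li' -> labelling (exits (complement K)) lo' ->
    (forall i, val (li' i) = val (lo i)) -> (forall i, val (lo' i) = val (li i)) ->
  gluing (G := G) (H1 := subgraph K) (H2 := complement K) val val val val li lo li' lo'.
Proof.
move=> lab_li lab_lo lab_li' lab_lo' eq_li' eq_lo'; split=> //.
- exact: subgraph_2digraph.
- exact: subgraph_2digraph.
- exact: subgraph_embedding.
- exact: subgraph_embedding.
- move=> [a aU] [b bU'] /=; apply: contraTneq aU => ->.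
  by rewrite -cover_compl.
move=> c; case: (boolP (c \in cover K)) => [cU | ]; first by left; exists (exist _ c cU).
by rewrite -cover_compl // => cU'; right; exists (exist _ c cU').
Qed.

End Complement.

(** * Identification of exits with entries *)

Section Glue.
Variables H H' : digraph.
Variable phi : {v : verts H | is_exit v} -> {v : verts H' | is_entry v}.
Variable psi : {v : verts H' | is_exit v} -> {v : verts H | is_entry v}.
Hypotheses (H_2 : is_2digraph H) (H'_2 : is_2digraph H').
Hypotheses (phi_bij : bijective phi) (psi_bij : bijective psi).

Let D := dunion H H'.
Let cl : rel (verts D) := sym_clos (glue_rel phi psi).
Let G' := glue phi psi.

Definition linked (u : verts H) (v : verts H') :=
  [exists w, (val w == u) && (val (phi w) == v)]
  || [exists w, (val w == v) && (val (psi w) == u)].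

Lemma linkedP u v : linked u v ->
  (exists w, val w = u /\ val (phi w) = v) \/ (exists w, val w = v /\ val (psi w) = u).
Proof. by case/orP=> /existsP[w /andP[/eqP eq1 /eqP eq2]]; [left | right]; exists w. Qed.

(** No vertex is both an entry and an exit, so the links made by [phi] and by [psi] never meet and
    [linked] is a partial matching. *)
Lemma linked_inj_r u v v' : linked u v -> linked u v' -> v = v'.
Proof.
case/linkedP=> [] [w [eq1 eq2]] /linkedP[] [w' [eq1' eq2']].
- by rewrite -eq2 -eq2'; congr (val (phi _)); apply/val_inj; rewrite eq1.
- by have := valP w; rewrite /= eq1 -eq2' (negPf (entry_not_exit (valP (psi w')))).
- by have := valP w'; rewrite /= eq1' -eq2 (negPf (entry_not_exit (valP (psi w)))).
- by rewrite -eq1 -eq1'; congr val; apply/(bij_inj psi_bij)/val_inj; rewrite eq2.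
Qed.

Lemma linked_inj_l u u' v : linked u v -> linked u' v -> u = u'.
Proof.
case/linkedP=> [] [w [eq1 eq2]] /linkedP[] [w' [eq1' eq2']].
- by rewrite -eq1 -eq1'; congr val; apply/(bij_inj phi_bij)/val_inj; rewrite eq2.
- by have := valP w'; rewrite /= eq1' -eq2 (negPf (entry_not_exit (valP (phi w)))).
- by have := valP w; rewrite /= eq1 -eq2' (negPf (entry_not_exit (valP (phi w')))).
- by rewrite -eq2 -eq2'; congr (val (psi _)); apply/val_inj; rewrite eq1.
Qed.

Let cl_cases x y : cl x y ->
  (exists u v, [/\ x = inl u, y = inr v & linked u v]) \/
  (exists u v, [/\ x = inr v, y = inl u & linked u v]).
Proof.
case: x y => [u | v] [u' | v'] //= cl_xy; [left; exists u, v' | right; exists u', v].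
  by split.
by split=> //; rewrite /linked orbC.
Qed.

(** A link changes sides and belongs to a matching, so two successive links lead back to the start:
    classes have at most two elements. *)
Lemma connect_glue x y : connect cl x y -> x = y \/ cl x y.
Proof.
case/connectP=> p; elim: p x => [|z p IH] x /=; first by left.
case/andP=> cl_xz path_p last_p; have [<- | cl_zy] := IH z path_p last_p; first by right.
left; case: (cl_cases cl_xz) => [] [u [v [-> eq_z luv]]];
  case: (cl_cases cl_zy) => [] [u' [v' [eq_z' -> luv']]].
- by rewrite eq_z in eq_z'.
- by move: eq_z'; rewrite eq_z => -[eq_v]; congr inl; apply: linked_inj_l luv _; rewrite eq_v.
- by move: eq_z'; rewrite eq_z => -[eq_u]; congr inr; apply: linked_inj_r luv _; rewrite eq_u.
- by rewrite eq_z in eq_z'.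
Qed.

Definition glue_class (x : verts D) : verts G' :=
  exist _ (root cl x) (roots_root (sym_clos_connect (glue_rel phi psi)) x).

Definition glue_l (u : verts H) := glue_class (inl u).
Definition glue_r (v : verts H') := glue_class (inr v).
Definition arc_l (a : arcs H) : arcs G' := inl a.
Definition arc_r (a : arcs H') : arcs G' := inr a.

Lemma glue_class_eq x y : (glue_class x == glue_class y) = connect cl x y.
Proof. exact: (root_connect (sym_clos_connect (glue_rel phi psi)) x y). Qed.

Lemma glue_class_onto z : exists x, z = glue_class x.
Proof. by case: z => x xP; exists x; apply/val_inj; rewrite /= (eqP xP). Qed.

Lemma embedding_l : embedding glue_l arc_l.
Proof.
split=> // [u u' /eqP | a b []] //.
by rewrite glue_class_eq => /connect_glue[[] | ].
Qed.

Lemma embedding_r : embedding glue_r arc_r.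
Proof.
split=> // [v v' /eqP | a b []] //.
by rewrite glue_class_eq => /connect_glue[[] | ].
Qed.

Lemma glue_linked u v : (glue_l u == glue_r v) = linked u v.
Proof.
rewrite glue_class_eq; apply/idP/idP => [/connect_glue[] // | luv].
exact: connect1.
Qed.

Lemma indeg_glue z : indeg z =
  #|[set a | glue_l (tgt a) == z]| + #|[set a | glue_r (tgt a) == z]|.
Proof.
rewrite /indeg -!sum1_card big_sumType /=.
by congr (_ + _); apply: eq_bigl => a; rewrite !inE.
Qed.

Lemma outdeg_glue z : outdeg z =
  #|[set a | glue_l (src a) == z]| + #|[set a | glue_r (src a) == z]|.
Proof.
rewrite /outdeg -!sum1_card big_sumType /=.
by congr (_ + _); apply: eq_bigl => a; rewrite !inE.
Qed.

Let card_fibre (A : finType) (V W : eqType) (t : A -> V) (f : V -> W) v :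
  injective f -> #|[set a | f (t a) == f v]| = #|[set a | t a == v]|.
Proof. by move=> f_inj; apply: eq_card => a; rewrite !inE (inj_eq f_inj). Qed.

Let card_nofibre (A : finType) (V W : eqType) (t : A -> V) (f : V -> W) z :
  (forall v, f v != z) -> #|[set a | f (t a) == z]| = 0.
Proof.
by move=> no_f; apply/eqP; rewrite cards_eq0; apply/eqP/setP=> a; rewrite !inE; apply/negbTE.
Qed.

Lemma glue_linked_degrees u v : linked u v ->
  indeg (glue_l u) = indeg u + indeg v /\ outdeg (glue_l u) = outdeg u + outdeg v.
Proof.
rewrite -glue_linked => /eqP eq_uv; rewrite indeg_glue outdeg_glue.
rewrite !(card_fibre _ _ (emb_verts_inj embedding_l)) eq_uv.
by rewrite !(card_fibre _ _ (emb_verts_inj embedding_r)).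
Qed.

Lemma linked_saturated u v : linked u v -> is_saturated (glue_l u).
Proof.
move=> luv; rewrite /is_saturated; have [-> ->] := glue_linked_degrees luv.
case/linkedP: luv => [] [w [<- <-]].
  by case/andP: (valP w) => /eqP-> /eqP->; case/andP: (valP (phi w)) => /eqP-> /eqP->.
by case/andP: (valP w) => /eqP-> /eqP->; case/andP: (valP (psi w)) => /eqP-> /eqP->.
Qed.

(** Bijectivity of [phi] and [psi] links every entry and exit, and there degrees (2,0) and (0,2) add
    up to (2,2). An unlinked vertex was saturated in its part and keeps its degrees. *)
Lemma glue_2dd : is_2dd G'.
Proof.
have phi_exit u : is_exit u -> exists v, linked u v.
  move=> exit_u; exists (val (phi (exist _ u exit_u))); apply/orP; left.
  by apply/existsP; exists (exist _ u exit_u); rewrite !eqxx.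
have psi_entry u : is_entry u -> exists v, linked u v.
  have [psi' _ psiK] := psi_bij.
  move=> entry_u; exists (val (psi' (exist _ u entry_u))); apply/orP; right.
  by apply/existsP; exists (psi' (exist _ u entry_u)); rewrite psiK !eqxx.
have phi_entry v : is_entry v -> exists u, linked u v.
  have [phi' _ phiK] := phi_bij.
  move=> entry_v; exists (val (phi' (exist _ v entry_v))); apply/orP; left.
  by apply/existsP; exists (phi' (exist _ v entry_v)); rewrite phiK !eqxx.
have psi_exit v : is_exit v -> exists u, linked u v.
  move=> exit_v; exists (val (psi (exist _ v exit_v))); apply/orP; right.
  by apply/existsP; exists (exist _ v exit_v); rewrite !eqxx.
move=> z; have [[u | v] ->] := glue_class_onto z.
  case: (boolP [exists v, linked u v]) => [/existsP[v /linked_saturated] // |].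
  move/existsPn=> no_link.
  rewrite /is_saturated indeg_glue outdeg_glue.
  rewrite !(card_fibre _ _ (emb_verts_inj embedding_l)).
  rewrite !(@card_nofibre _ _ _ _ glue_r); try by move=> v; rewrite eq_sym glue_linked.
  rewrite !addn0; case/or3P: (H_2 u) => [/psi_entry | /phi_exit | //] [v luv];
    by have := no_link v; rewrite luv.
case: (boolP [exists u, linked u v]) => [/existsP[u luv] | /existsPn no_link].
  by have := linked_saturated luv; move: luv; rewrite -glue_linked => /eqP->.
rewrite /is_saturated indeg_glue outdeg_glue.
rewrite !(card_fibre _ _ (emb_verts_inj embedding_r)).
rewrite !(@card_nofibre _ _ _ _ glue_l); try by move=> u; rewrite glue_linked.
rewrite !add0n; case/or3P: (H'_2 v) => [/phi_entry | /psi_exit | //] [u luv];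
  by have := no_link u; rewrite luv.
Qed.

Lemma glue_ac6 :
    (forall a : arcs H, #|[set b | connect twin a b]| = 6) ->
    (forall a : arcs H', #|[set b | connect twin a b]| = 6) ->
  all_ac6 G'.
Proof.
have G'2 := saturated_2digraph glue_2dd.
move=> ac6 ac6'; apply/(all_ac6P G'2) => -[a | a].
  by rewrite (card_component_emb H_2 G'2 embedding_l).
by rewrite (card_component_emb H'_2 G'2 embedding_r).
Qed.

(** The new part [H'] comes first, so its routes are left factors, like those of the subgraph in
    [subgraph_gluing]. *)
Lemma glue_gluing n (li lo : 'I_n -> verts H) (li' lo' : 'I_n -> verts H') :
    labelling (entries H) li -> labelling (exits H) lo ->
    labelling (entries H') li' -> labelling (exits H') lo' ->
    (forall i w, val w = lo i -> val (phi w) = li' i) ->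
    (forall i w, val w = lo' i -> val (psi w) = li i) ->
  gluing glue_r arc_r glue_l arc_l li' lo' li lo.
Proof.
move=> lab_li lab_lo lab_li' lab_lo' phiP psiP; split=> //.
- exact: glue_2dd.
- exact: embedding_r.
- exact: embedding_l.
- by case=> a; [right | left]; exists a.
- move=> i; apply/esym/eqP; rewrite glue_linked; apply/orP; right; apply/existsP.
  have exit_i : is_exit (lo' i) by have := labelling_mem i lab_lo'; rewrite inE.
  by exists (exist (fun v => is_exit v) _ exit_i); rewrite eqxx (psiP i) ?eqxx.
move=> i; apply/eqP; rewrite glue_linked; apply/orP; left; apply/existsP.
have exit_i : is_exit (lo i) by have := labelling_mem i lab_lo; rewrite inE.
by exists (exist (fun v => is_exit v) _ exit_i); rewrite eqxx (phiP i) ?eqxx.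
Qed.

End Glue.

(** * Transfer of the Hamiltonicity criterion along equal residues *)

Lemma card_porbits_conj (T : finType) (s t : {perm T}) :
  #|porbits (s ^ t)%g| = #|porbits s|.
Proof.
have -> : porbits (s ^ t)%g = (fun x => porbit (s ^ t) (t x)) @: T.
  apply/setP=> A; apply/imsetP/imsetP=> [[x _ ->] | [x _ ->]].
    by exists ((t^-1)%g x); rewrite // permKV.
  by exists (t x).
apply: card_imset_same_kernel => x y; rewrite !eq_porbit_mem.
apply/porbitP/porbitP => -[k eq_k]; exists k.
  by apply: (@perm_inj _ t); rewrite eq_k -conjXg permJ.
by rewrite eq_k -conjXg permJ.
Qed.

(* When the residues are empty, x and y say nothing about the parity classes of
   P and P'; but then every q in Q completes some p in P to a full cycle, and
   it suffices to choose u and w so that a single product over P' is one. *)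
Lemma residue_transfer n (P P' Q : {set 'S_n}) (x y : 'S_n) :
    P != set0 -> P' != set0 ->
    (forall p q, p \in P -> q \in Q -> odd #|porbits (p * q)%g|) ->
    residue P = [set (x * r * y)%g | r in residue P'] ->
  exists u w : 'S_n,
    (exists p q, [/\ p \in P, q \in Q & (p * q)%g \in full_cycles n]) <->
    (exists p q, [/\ p \in P', q \in Q & (u * p * w * q)%g \in full_cycles n]).
Proof.
move=> /set0Pn[p0 Pp0] /set0Pn[p1 P'p1] odd_PQ eq_res.
pose class (R : {set 'S_n}) : {set 'S_n} :=
  if parity R == odd n then ~: ('Alt_('I_n))%g else ('Alt_('I_n))%g.
have class_sign R s t : s \in class R -> (t \in class R) = (odd_perm t == odd_perm s).
  by rewrite /class; case: ifP => _; rewrite ?in_setC !Alt_even; do 2 case: odd_perm.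
(* The sign of a permutation is the parity of [n] minus its number of orbits; as that number is odd,
   [p * q] has the sign of a full cycle. *)
have sign_PQ p q : p \in P -> q \in Q -> odd_perm p = ~~ odd n (+) odd_perm q.
  move=> Pp Qq; have := odd_permM p q; rewrite {1}/odd_perm card_ord odd_PQ // addbT => ->.
  by rewrite addbK.
have sQ_class q : q \in Q -> q \in class P.
  move=> Qq; have parityP : parity P = odd_perm p0.
    apply/idP/idP => [/subsetPn[p Pp] | odd_p0].
      by rewrite Alt_even negbK (sign_PQ p q) // (sign_PQ p0 q).
    by apply/subsetPn; exists p0; rewrite // Alt_even negbK.
  rewrite /class parityP (sign_PQ p0 q) //; have := Alt_even q.
  by case: (odd n); case: ifP; rewrite ?in_setC => + ->; case: odd_perm.
have ediffP (R : {set 'S_n}) q :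
    reflect (exists2 p, p \in R & (p * q)%g \in full_cycles n) (q \in ediff R).
  apply: (iffP imset2P) => [[p c Rp full_c ->] | [p Rp full_pq]].
    by exists p; rewrite // mulKVg.
  by exists p (p * q)%g; rewrite // mulKg.
have residueE (R : {set 'S_n}) s : (s \in residue R) = (s \in class R) && (s \notin ediff R).
  by rewrite /residue inE andbC.
case: (set_0Vmem Q) => [Q0 | [q Qq]].
  by exists 1%g, 1%g; split=> [] [p [q []]]; rewrite Q0 inE.
case: (set_0Vmem (residue P)) => [res0 | [r1 res_r1]].
  have /ediffP[p Pp full_pq] : q \in ediff P.
    by apply: contraT => nE; rewrite -(in_set0 q) -res0 residueE sQ_class.
  (* The second witness solves [p1 * w * q = p * q]. *)
  exists 1%g, (p1^-1 * (p * q) * q^-1)%g; split=> _; last by exists p, q.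
  by exists p1, q; rewrite mul1g -!mulgA mulVg mulg1 mulKVg.
(* Conjugation moves [y^-1] to the other end, so that multiplying routes in [P'] on both sides
   becomes transforming [q']. *)
have conjE p q' : (y^-1 * p * x^-1 * q' \in full_cycles n)%g
    = (p * (x^-1 * q' * y^-1) \in full_cycles n)%g.
  rewrite !inE -(card_porbits_conj _ y^-1); congr (#|porbits _| == 1).
  by rewrite conjgE invgK !mulgA mulgV mul1g.
(* The pair [r0], [r1] compares the sign classes: [q'] in the class of [P] is sent by
   [x^-1 * q' * y^-1] into that of [P']. *)
have /imsetP[r0 res_r0 eq_r1] : r1 \in [set (x * r * y)%g | r in residue P'].
  by rewrite -eq_res.
have class_r1 : r1 \in class P by move: res_r1; rewrite residueE => /andP[].
have class_r0 : r0 \in class P' by move: res_r0; rewrite residueE => /andP[].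
have shift q' : (x * (x^-1 * q' * y^-1) * y)%g = q' by rewrite !mulgA mulgV mul1g mulgKV.
have in_residue q' : (q' \in residue P) = (x^-1 * q' * y^-1 \in residue P')%g.
  rewrite eq_res; apply/imsetP/idP => [[r res_r ->] | res_q].
    by rewrite !mulgA mulVg mul1g mulgK.
  by exists (x^-1 * q' * y^-1)%g.
(* Elements of [Q] and their transforms lie in the respective classes, where being outside the
   residue is the same as being in [ediff]. *)
have in_ediff q' : q' \in Q -> (q' \in ediff P) = (x^-1 * q' * y^-1 \in ediff P')%g.
  move=> Qq'; have := in_residue q'; rewrite !residueE sQ_class //.
  suff -> : (x^-1 * q' * y^-1 \in class P')%g by do 2 case: (_ \in ediff _).
  rewrite (class_sign _ _ _ class_r0); have := sQ_class _ Qq'.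
  rewrite (class_sign _ _ _ class_r1) eq_r1 !odd_permM !odd_permV => /eqP ->.
  by do 3 case: odd_perm.
exists y^-1%g, x^-1%g; split=> [] [p [q' [Pp Qq' full]]].
  have : q' \in ediff P by apply/ediffP; exists p.
  by rewrite in_ediff // => /ediffP[p' P'p' full']; exists p', q'; rewrite conjE.
have : (x^-1 * q' * y^-1)%g \in ediff P' by apply/ediffP; exists p; rewrite // -conjE.
by rewrite -in_ediff // => /ediffP[p' P'p' full']; exists p', q'.
Qed.

Theorem lemma2 (G : digraph) (K : {set {set arcs G}}) (F' : digraph) (n : nat)
    (G_2dd : is_2dd G) (G_odd : is_odd G) (G_ac6 : all_ac6 G)
    (K_neq0 : K != set0) (K_proper : K \proper ACs G)
    (F_open : is_open (subgraph K))
    (n_ge1 : 1 <= n) (F_exits : #|exits (subgraph K)| = n)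
    (F'_2digraph : is_2digraph F') (F'_open : is_open F')
    (F'_ac6 : all_ac6 F') (F'_exits : #|exits F'| = n)
    (F'_sim_F : sim n (subgraph K) F') :
  exists (phi : {v : verts (complement K) | is_exit v} ->
                {v : verts F' | is_entry v})
         (psi : {v : verts F' | is_exit v} ->
                {v : verts (complement K) | is_entry v}),
    [/\ bijective phi, bijective psi
      & let G' := glue phi psi in
        [/\ is_2dd G', all_ac6 G' & H_equivalent G G']].
Proof.
have sKA := proper_sub K_proper; have G2 := saturated_2digraph G_2dd.
have F2 := subgraph_2digraph G_2dd sKA.
have Fc2 : is_2digraph (complement K) := subgraph_2digraph G_2dd (subsetDl _ _).
have [li [lo [li' [lo' [lab_li lab_lo lab_li' lab_lo' [x [y eq_res]]]]]]] := F'_sim_F.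
have [ci [co [lab_ci lab_co eq_ci eq_co]]] := complement_labellings G_2dd sKA lab_li lab_lo.
have glu := subgraph_gluing G_2dd sKA lab_li lab_lo lab_ci lab_co eq_ci eq_co.
have odd_PQ p q :
    p \in open_routes li lo -> q \in open_routes ci co -> odd #|porbits (p * q)%g|.
  by move=> rp rq; have [S facS <-] := glued_routes glu rp rq; apply: G_odd.
have [u [w ham_iff]] := residue_transfer (open_routes_neq0 F2 F_open lab_li lab_lo)
  (open_routes_neq0 F'_2digraph F'_open lab_li' lab_lo') odd_PQ eq_res.
have relabel A l (s : 'S_n) : @labelling F' n A l -> labelling A (l \o s).
  move=> lab; split=> [|]; first exact: (inj_comp lab.1 perm_inj).
  apply/setP=> v; apply/imsetP/idP => [[i _ ->] | /(labelling_onto lab)[i ->]].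
    exact: labelling_mem lab.
  by exists ((s^-1)%g i); rewrite //= permKV.
(* Relabelling the entries and exits of [F'] absorbs [u] and [w], so identifying vertices of equal
   label realises the routes [u * p * w]. *)
have lab_li'' := relabel _ _ u lab_li'; have lab_lo'' := relabel _ _ (w^-1)%g lab_lo'.
have [phi phi_bij phiP] := labelled_bijection lab_co lab_li''.
have [psi psi_bij psiP] := labelled_bijection lab_lo'' lab_ci.
have G'dd := glue_2dd Fc2 F'_2digraph phi_bij psi_bij.
exists phi, psi; split=> //; split=> //.
  apply: glue_ac6 => // a; last exact: (all_ac6P F'_2digraph).1.
  (* The ACs of the complement are ACs of [G], where their size is known. *)
  rewrite -(card_component_emb Fc2 G2 (subgraph_embedding _)).
  exact: (all_ac6P G2).1.
have glu' := glue_gluing Fc2 F'_2digraph phi_bij psi_bij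
  lab_ci lab_co lab_li'' lab_lo'' phiP psiP.
apply: iff_trans (glued_hamiltonian glu n_ge1) _; apply: iff_trans ham_iff _.
apply: iff_trans (iff_sym (glued_hamiltonian glu' n_ge1)).
split=> [] [p [q [rp rq full]]].
  by exists (u * p * w)%g, q; split; rewrite ?open_routes_relabel.
exists (u^-1 * p * w^-1)%g, q; split=> //.
  by rewrite -(open_routes_relabel _ _ u w) !mulgA mulgV mul1g mulgKV.
by rewrite !mulgA mulgV mul1g mulgKV.
Qed.
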